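(* Suppose the following hold for the federated compositional problem and the FedCoMuon-VR algorithm described in the context. (1) $F_*:=\inf_{W\in\mathbb R^{m\times n}}F(W)>-\infty$. (2) There are constants $\sigma_g,\sigma_{\nabla g},\sigma_f>0$ such that for all $k\in[K]$, $W\in\mathbb R^{m\times n}$, $y\in\mathbb R^d$: $\mathbb E_{\xi^k}[g^k(W;\xi^k)]=g^k(W)$, $\mathbb E_{\xi^k}[\nabla g^k(W;\xi^k)]=\nabla g^k(W)$, $\mathbb E_{\zeta^k}[\nabla_y f^k(y;\zeta^k)]=\nabla_y f^k(y)$, $\mathbb E_{\xi^k}\|g^k(W;\xi^k)-g^k(W)\|^2\le\sigma_g^2$, $\mathbb E_{\xi^k}\|\nabla g^k(W;\xi^k)-\nabla g^k(W)\|_F^2\le\sigma_{\nabla g}^2$, $\mathbb E_{\zeta^k}\|\nabla_y f^k(y;\zeta^k)-\nabla_y f^k(y)\|^2\le\sigma_f^2$; the samples are independent across clients and iterations, and $\xi^k$ is independent of $\zeta^k$. (3) For all $k,W,y$: $\mathbb E_{\xi^k}\|\nabla g^k(W;\xi^k)\|_F^2\le C_g^2$ and $\mathbb E_{\zeta^k}\|\nabla_y f^k(y;\zeta^k)\|^2\le C_f^2$, where $C_g,C_f>0$ are the constants used in the algorithm's projections. (4) There are constants $L_g,L_f$ such that for all $k$, $W_1,W_2$, $y_1,y_2$: $\mathbb E_{\xi^k}\|g^k(W_1;\xi^k)-g^k(W_2;\xi^k)\|^2\le C_g^2\|W_1-W_2\|_F^2$, $\mathbb E_{\xi^k}\|\nabla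 g^k(W_1;\xi^k)-\nabla g^k(W_2;\xi^k)\|_F^2\le L_g^2\|W_1-W_2\|_F^2$, $\mathbb E_{\zeta^k}\|\nabla_yf^k(y_1;\zeta^k)-\nabla_yf^k(y_2;\zeta^k)\|^2\le L_f^2\|y_1-y_2\|^2$. (5) There are constants $\Delta_g,\Delta_{\nabla g},\Delta_f\ge0$ such that for all $k,j\in[K]$, $W$, $y$: $\|\nabla_yf^k(y)-\nabla_yf^j(y)\|\le\Delta_f$, $\|\nabla g^k(W)-\nabla g^j(W)\|_F\le\Delta_{\nabla g}$, $\|g^k(W)-g^j(W)\|\le\Delta_g$. Fix $\tau_0\ge1$. Then there is a constant $C$, depending only on $n,\tau_0,F(W_0)-F_*$ and the constants in (2)–(5), such that for every integer $T\ge2$ for which $T^{2/3}$ is an integer and every integer $1\le\tau\le\tau_0$, FedCoMuon-VR run with $\eta=\alpha=\beta=\gamma=T^{-2/3}$, $\rho=T^{-1/3}$, $b=T^{2/3}$ and this $\tau$ satisfies $$\frac1T\sum_{t=0}^{T-1}\mathbb E\|\nabla F(\bar W_t)\|_F\le C\,T^{-1/3}.$$ Consequently there is a constant $C'$ (with the same dependence) such that for every $\epsilon\in(0,1]$ and every such $\tau$, some such $T$ yields $\frac1T\sum_{t=0}^{T-1}\mathbb E\|\nabla F(\bar W_t)\|_F\le\epsilon$ with $T\le C'\epsilon^{-3}$, with at most $C'\epsilon^{-3}$ stochastic samples drawn per client (the initial batches together with the $T$ iterations), and with at most $T/\tau\le C'\epsilon^{-3}$ communication rounds.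
   Context: Problem. Let $K,m,n,d\ge1$ be integers, $[K]=\{1,\dots,K\}$. For each $k\in[K]$ let $\mathcal D_g^k,\mathcal D_f^k$ be probability distributions, and let $g^k(W;\xi)\in\mathbb R^d$ ($W\in\mathbb R^{m\times n}$, $\xi\sim\mathcal D_g^k$) and $f^k(y;\zeta)\in\mathbb R$ ($y\in\mathbb R^d$, $\zeta\sim\mathcal D_f^k$) be differentiable in $W$, resp. $y$. Put $g^k(W)=\mathbb E_\xi[g^k(W;\xi)]$, $f^k(y)=\mathbb E_\zeta[f^k(y;\zeta)]$ (also differentiable), $F^k(W)=f^k(g^k(W))$, $F(W)=\frac1K\sum_{k=1}^KF^k(W)$. $\|\cdot\|$ is the Euclidean norm of vectors, $\|\cdot\|_F$ the Frobenius norm, $\otimes$ the Kronecker product. The Jacobian $\nabla g^k(W)$ is the $m\times nd$ matrix $[\nabla g^k_1(W),\dots,\nabla g^k_d(W)]$ of the $m\times n$ gradients of the components (similarly for $\nabla g^k(W;\xi)$), so that $\nabla g^k(W)(v\otimes I_n)=\sum_{i=1}^d v_i\nabla g_i^k(W)$ for $v\in\mathbb R^d$ and $\nabla F^k(W)=\nabla g^k(W)(\nabla_yf^k(g^k(W))\otimes I_n)$. FedCoMuon-VR algorithm. Inputs: $\eta>0$, $\alpha,\beta,\gamma,\rho\in[0,1)$, integers $\tau,b\ge1$, constants $C_f,C_g>0$, deterministic $W_0\in\mathbb R^{m\times n}$. $\Pi_{C_f}$ and $\Pi_{C_g}$ are the Euclidean projections onto $\{v\in\mathbb R^d:\|v\|\le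 C_f\}$ and $\{H\in\mathbb R^{m\times nd}:\|H\|_F\le C_g\}$. Initialization: $W_0^k=W_0$; draw i.i.d. $\xi_{0,1}^k,\dots,\xi_{0,b}^k\sim\mathcal D_g^k$ and i.i.d. $\zeta_{0,1}^k,\dots,\zeta_{0,b}^k\sim\mathcal D_f^k$; set $u_0^k=\frac1b\sum_jg^k(W_0;\xi_{0,j}^k)$, $H_0^k=\frac1b\sum_j\nabla g^k(W_0;\xi_{0,j}^k)$, $v_0^k=\frac1b\sum_j\nabla_yf^k(u_0^k;\zeta_{0,j}^k)$, and, for all $k$, $M_0^k=\frac1K\sum_{j=1}^KH_0^j(v_0^j\otimes I_n)$. For $t=0,1,2,\dots$: each client takes a compact singular value decomposition $M_t^k=U_t^k\Sigma_t^k(V_t^k)^\top$ (only nonzero singular values) and sets $\tilde W_{t+1}^k=W_t^k-\eta U_t^k(V_t^k)^\top$. If $\tau$ divides $t+1$ (a communication round), $W_{t+1}^k=\frac1K\sum_j\tilde W_{t+1}^j$ for all $k$; otherwise $W_{t+1}^k=\tilde W_{t+1}^k$. Then each client draws fresh $\xi_{t+1}^k\sim\mathcal D_g^k$, $\zeta_{t+1}^k\sim\mathcal D_f^k$ and sets $u_{t+1}^k=g^k(W_{t+1}^k;\xi_{t+1}^k)+(1-\alpha)(u_t^k-g^k(W_t^k;\xi_{t+1}^k))$, $v_{t+1}^k=\Pi_{C_f}[\nabla_yf^k(u_{t+1}^k;\zeta_{t+1}^k)+(1-\beta)(v_t^k-\nabla_yf^k(u_t^k;\zeta_{t+1}^k))]$,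 $H_{t+1}^k=\Pi_{C_g}[\nabla g^k(W_{t+1}^k;\xi_{t+1}^k)+(1-\gamma)(H_t^k-\nabla g^k(W_t^k;\xi_{t+1}^k))]$, $\tilde M_{t+1}^k=(1-\rho)M_t^k+\rho H_{t+1}^k(v_{t+1}^k\otimes I_n)$. If $\tau$ divides $t+1$, $M_{t+1}^k=\frac1K\sum_j\tilde M_{t+1}^j$ for all $k$; otherwise $M_{t+1}^k=\tilde M_{t+1}^k$. Write $\bar W_t=\frac1K\sum_kW_t^k$, $\bar M_t=\frac1K\sum_kM_t^k$. $\mathbb E$ is over all samples. *)

(* Defs.v *)
From HB Require Import structures.
From mathcomp Require Import all_boot all_order all_algebra.
From mathcomp Require Import all_classical all_reals all_analysis.
Import Order.TTheory GRing.Theory Num.Theory.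
Import numFieldNormedType.Exports.

Set Implicit Arguments.
Unset Strict Implicit.
Unset Printing Implicit Defensive.

Local Open Scope classical_set_scope.
Local Open Scope ring_scope.

(* Frobenius norm; on column vectors this is the Euclidean norm.  (The norm
   `|A| that the library puts on matrices is the max norm, which is used below
   only through the notion of differentiability.) *)
Definition fnorm {R : realType} {p q : nat} (A : 'M[R]_(p, q)) : R :=
  Num.sqrt (\sum_i \sum_j A i j ^+ 2).

Definition is_projection {R : realType} {p q : nat} (C : R)
    (A B : 'M[R]_(p, q)) : Prop :=
  fnorm B <= C /\ (forall X, fnorm X <= C -> fnorm (A - B) <= fnorm (A - X)).

Definition grad {R : realType} {p q : nat} (phi : 'M[R]_(p, q) -> R)
    (W : 'M[R]_(p, q)) : 'M[R]_(p, q) :=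
  \matrix_(i, j) 'D_(delta_mx i j) (phi : 'M[R]_(p, q) -> R^o) W.

(* [grad G_1, ..., grad G_d]; the width nd is written as a sum of d copies
   of n, as required by the library's block matrices. *)
Definition jac {R : realType} {m n d : nat} (G : 'M[R]_(m, n) -> 'cV[R]_d)
    (W : 'M[R]_(m, n)) : 'M[R]_(m, \sum_(i < d) n) :=
  \mxrow_(i < d) grad (fun X => G X i 0) W.

(* The Kronecker product of v and I_n: the column of the blocks v_i I_n. *)
Definition kronI {R : realType} {d : nat} (n : nat) (v : 'cV[R]_d) :
    'M[R]_(\sum_(i < d) n, n) :=
  \mxcol_(i < d) (v i 0)%:M.

Definition compact_svd {R : realType} {m n r : nat} (M : 'M[R]_(m, n))
    (U : 'M[R]_(m, r)) (s : 'rV[R]_r) (V : 'M[R]_(n, r)) : Prop :=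
  [/\ U^T *m U = 1%:M, V^T *m V = 1%:M, (forall i, 0 < s 0 i) &
      M = U *m diag_mx s *m V^T].

(* U V^T does not depend on the compact SVD of M that is chosen. *)
Definition is_orthogonalization {R : realType} {m n : nat}
    (M O : 'M[R]_(m, n)) : Prop :=
  exists r (U : 'M[R]_(m, r)) (s : 'rV[R]_r) (V : 'M[R]_(n, r)),
    compact_svd M U s V /\ O = U *m V^T.

Definition avg {R : realType} {V : lmodType R} {K : nat} (X : 'I_K -> V) : V :=
  K%:R^-1 *: \sum_(k < K) X k.

(* Entrywise expectation, required to exist. *)
Definition has_mean {disp : measure_display} {T : measurableType disp}
    {R : realType} (P : probability T R) {p q : nat} (X : T -> 'M[R]_(p, q))
    (M : 'M[R]_(p, q)) : Prop :=
  forall i j, P.-integrable setT (fun w => (X w i j)%:E) /\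
    ('E_P[fun w => X w i j] = (M i j)%:E)%E.

Definition mean_square_le {disp : measure_display} {T : measurableType disp}
    {R : realType} (P : probability T R) {p q : nat} (X : T -> 'M[R]_(p, q))
    (s : R) : Prop :=
  ('E_P[fun w => (fnorm (X w) ^+ 2)%R] <= s%:E)%E.

(* Mutual independence of the classes of events E i. *)
Definition mutually_independent {disp : measure_display}
    {T : measurableType disp} {R : realType} (P : probability T R)
    {I : eqType} (E : I -> set (set T)) : Prop :=
  forall (J : seq I) (A : I -> set T), uniq J ->
    (forall i, i \in J -> E i (A i)) ->
    P (\bigcap_(i in [set` J]) A i) = (\prod_(i <- J) P (A i))%E.

(* gs k W x and fs k y z are the stochastic functions g^k(W; xi) and
   f^k(y; zeta), g and f their expectations. *)
Record problem (R : realType) (K m n d : nat) := Problem {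
  disp_g : measure_display;
  disp_f : measure_display;
  spg : 'I_K -> measurableType disp_g;
  spf : 'I_K -> measurableType disp_f;
  Dg : forall k, probability (spg k) R;
  Df : forall k, probability (spf k) R;
  gs : forall k, 'M[R]_(m, n) -> spg k -> 'cV[R]_d;
  fs : forall k, 'cV[R]_d -> spf k -> R;
  g : 'I_K -> 'M[R]_(m, n) -> 'cV[R]_d;
  f : 'I_K -> 'cV[R]_d -> R;
  gs_measurable : forall k W i, measurable_fun setT (fun x => gs (k := k) W x i 0);
  fs_measurable : forall k y, measurable_fun setT (fs (k := k) y);
  gs_differentiable : forall k W x, differentiable (fun X => gs (k := k) X x) W;
  fs_differentiable : forall k y z,
    differentiable ((fun v => fs (k := k) v z) : 'cV[R]_d -> R^o) y;
  g_differentiable : forall k W, differentiable (g k) W;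
  f_differentiable : forall k y, differentiable (f k : 'cV[R]_d -> R^o) y;
  g_mean : forall k W, has_mean (Dg k) (gs (k := k) W) (g k W);
  f_mean : forall k y,
    (Df k).-integrable setT (fun z => (fs (k := k) y z)%:E) /\
    ('E_(Df k)[fs (k := k) y] = (f k y)%:E)%E
}.
Arguments Dg {R K m n d} p k : rename.
Arguments Df {R K m n d} p k : rename.
Arguments gs {R K m n d} p k W x : rename.
Arguments fs {R K m n d} p k y z : rename.

Definition objective {R : realType} {K m n d : nat} (pb : problem R K m n d)
    (W : 'M[R]_(m, n)) : R :=
  K%:R^-1 * \sum_(k < K) f pb k (g pb k W).

Definition grad_gs {R : realType} {K m n d : nat} (pb : problem R K m n d)
    (k : 'I_K) (W : 'M[R]_(m, n)) (x : spg pb k) : 'M[R]_(m, \sum_(i < d) n) :=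
  jac (fun X => gs pb k X x) W.

Definition grad_fs {R : realType} {K m n d : nat} (pb : problem R K m n d)
    (k : 'I_K) (y : 'cV[R]_d) (z : spf pb k) : 'cV[R]_d :=
  grad (fun v => fs pb k v z) y.

Record constants (R : realType) := Constants {
  sigma_g : R; sigma_jac_g : R; sigma_f : R;
  C_g : R; C_f : R;
  L_g : R; L_f : R;
  Delta_g : R; Delta_jac_g : R; Delta_f : R
}.

Record constants_ok {R : realType} (c : constants R) : Prop := {
  sigma_g_gt0 : 0 < sigma_g c;
  sigma_jac_g_gt0 : 0 < sigma_jac_g c;
  sigma_f_gt0 : 0 < sigma_f c;
  C_g_gt0 : 0 < C_g c;
  C_f_gt0 : 0 < C_f c;
  Delta_g_ge0 : 0 <= Delta_g c;
  Delta_jac_g_ge0 : 0 <= Delta_jac_g c;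
  Delta_f_ge0 : 0 <= Delta_f c
}.

(* Unbiasedness of gs itself is the field g_mean of problem. *)
Record assumptions {R : realType} {K m n d : nat} (pb : problem R K m n d)
    (c : constants R) : Prop := {
  objective_bounded_below : has_lbound (range (objective pb));
  grad_gs_mean : forall k W,
    has_mean (Dg pb k) (grad_gs (k := k) W) (jac (g pb k) W);
  grad_fs_mean : forall k y,
    has_mean (Df pb k) (grad_fs (k := k) y) (grad (f pb k) y);
  gs_variance : forall k W,
    mean_square_le (Dg pb k) (fun x => gs pb k W x - g pb k W)
      (sigma_g c ^+ 2);
  grad_gs_variance : forall k W,
    mean_square_le (Dg pb k) (fun x => grad_gs W x - jac (g pb k) W)
      (sigma_jac_g c ^+ 2);
  grad_fs_variance : forall k y,
    mean_square_le (Df pb k) (fun z => grad_fs y z - grad (f pb k) y)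
      (sigma_f c ^+ 2);
  grad_gs_bound : forall k W,
    mean_square_le (Dg pb k) (grad_gs (k := k) W)
      (C_g c ^+ 2);
  grad_fs_bound : forall k y,
    mean_square_le (Df pb k) (grad_fs (k := k) y)
      (C_f c ^+ 2);
  gs_lipschitz : forall k W1 W2,
    mean_square_le (Dg pb k) (fun x => gs pb k W1 x - gs pb k W2 x)
      (C_g c ^+ 2 * fnorm (W1 - W2) ^+ 2);
  grad_gs_lipschitz : forall k W1 W2,
    mean_square_le (Dg pb k) (fun x => grad_gs W1 x - grad_gs W2 x)
      (L_g c ^+ 2 * fnorm (W1 - W2) ^+ 2);
  grad_fs_lipschitz : forall k y1 y2,
    mean_square_le (Df pb k) (fun z => grad_fs y1 z - grad_fs y2 z)
      (L_f c ^+ 2 * fnorm (y1 - y2) ^+ 2);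
  grad_f_heterogeneity : forall k j y,
    fnorm (grad (f pb k) y - grad (f pb j) y) <= Delta_f c;
  jac_g_heterogeneity : forall k j W,
    fnorm (jac (g pb k) W - jac (g pb j) W) <= Delta_jac_g c;
  g_heterogeneity : forall k j W,
    fnorm (g pb k W - g pb j W) <= Delta_g c
}.

Record hyperparameters (R : realType) := Hyperparameters {
  eta : R; alpha : R; beta : R; gamma : R; rho : R; tau : nat
}.

Record state (R : realType) (K m n d : nat) := State {
  stW : 'I_K -> 'M[R]_(m, n);
  stu : 'I_K -> 'cV[R]_d;
  stv : 'I_K -> 'cV[R]_d;
  stH : 'I_K -> 'M[R]_(m, \sum_(i < d) n);
  stM : 'I_K -> 'M[R]_(m, n)
}.

Definition init_state {R : realType} {K m n d : nat} (pb : problem R K m n d)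
    (W0 : 'M[R]_(m, n)) (b : nat) (x : forall k, 'I_b -> spg pb k)
    (z : forall k, 'I_b -> spf pb k) : state R K m n d :=
  let u k := avg (fun j : 'I_b => gs pb k W0 (x k j)) in
  let v k := avg (fun j : 'I_b => grad_fs (u k) (z k j)) in
  let H k := avg (fun j : 'I_b => grad_gs W0 (x k j)) in
  let M := avg (fun k => H k *m kronI n (v k)) in
  State (fun=> W0) u v H (fun=> M).

(* The t-th iteration, from the state of index t to the state of index t + 1,
   x and z being the samples of index t + 1. *)
Definition step {R : realType} {K m n d : nat} (pb : problem R K m n d)
    (Cg Cf : R) (h : hyperparameters R) (t : nat) (x : forall k, spg pb k)
    (z : forall k, spf pb k) (s s' : state R K m n d) : Prop :=
  exists2 O : 'I_K -> 'M[R]_(m, n),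
    (forall k, is_orthogonalization (stM s k) (O k)) &
    let Wt k := stW s k - eta h *: O k in
    let Mt k := (1 - rho h) *: stM s k
                + rho h *: (stH s' k *m kronI n (stv s' k)) in
    let comm := (tau h %| t.+1)%N in
    forall k,
    [/\ stW s' k = (if comm then avg Wt else Wt k),
        stu s' k = gs pb k (stW s' k) (x k)
                   + (1 - alpha h) *: (stu s k - gs pb k (stW s k) (x k)),
        is_projection Cf
          (grad_fs (stu s' k) (z k)
           + (1 - beta h) *: (stv s k - grad_fs (stu s k) (z k)))
          (stv s' k),
        is_projection Cg
          (grad_gs (stW s' k) (x k)
           + (1 - gamma h) *: (stH s k - grad_gs (stW s k) (x k)))
          (stH s' k) &
        stM s' k = (if comm then avg Mt else Mt k)].

(* Sample indices: inl j is the j-th sample of the initial batch, inr t the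
   sample of index t + 1, drawn in iteration t. *)
Definition slot (b : nat) := ('I_b + nat)%type.

Record is_sampling {R : realType} {K m n d : nat} (pb : problem R K m n d)
    (b : nat) (disp : measure_display) (Omega : measurableType disp)
    (P : probability Omega R) (xi : forall k, slot b -> Omega -> spg pb k)
    (zeta : forall k, slot b -> Omega -> spf pb k) : Prop := {
  xi_measurable : forall k s, measurable_fun setT (xi k s);
  zeta_measurable : forall k s, measurable_fun setT (zeta k s);
  xi_law : forall k s A, measurable A -> P (xi k s @^-1` A) = Dg pb k A;
  zeta_law : forall k s A, measurable A -> P (zeta k s @^-1` A) = Df pb k A;
  samples_independent : mutually_independent P
    (fun i : ('I_K * slot b) + ('I_K * slot b) =>
       match i with
       | inl (k, s) => preimage_set_system setT (xi k s) measurable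
       | inr (k, s) => preimage_set_system setT (zeta k s) measurable
       end)
}.

Definition is_run {R : realType} {K m n d : nat} (pb : problem R K m n d)
    (Cg Cf : R) (h : hyperparameters R) (W0 : 'M[R]_(m, n))
    (b : nat) (Omega : Type) (xi : forall k, slot b -> Omega -> spg pb k)
    (zeta : forall k, slot b -> Omega -> spf pb k)
    (st : nat -> Omega -> state R K m n d) : Prop :=
  forall w,
    st 0 w = init_state W0 (fun k j => xi k (inl j) w)
                           (fun k j => zeta k (inl j) w) /\
    forall t, step Cg Cf h t (fun k => xi k (inr t) w)
                             (fun k => zeta k (inr t) w) (st t w) (st t.+1 w).

Definition mean_grad_norm {R : realType} {K m n d : nat}
    (pb : problem R K m n d) (disp : measure_display)
    (Omega : measurableType disp) (P : probability Omega R)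
    (st : nat -> Omega -> state R K m n d) (T : nat) : \bar R :=
  ((T%:R^-1)%:E *
   \sum_(t < T) 'E_P[fun w => fnorm (grad (objective pb) (avg (stW (st t w))))])%E.

Definition schedule (R : realType) (T tau : nat) : hyperparameters R :=
  let a := T%:R `^ (- (2 / 3)) in
  Hyperparameters a a a a (T%:R `^ (- (1 / 3))) tau.

(* b + T samples of xi and as many of zeta *)
Definition samples_per_client (b T : nat) : nat := (2 * (b + T))%N.

Definition communication_rounds (tau T : nat) : nat :=
  count (fun t => (tau %| t.+1)%N) (iota 0 T).

(* Main.v *)
(* Orthogonalized momentum steps have bounded length, so client drift and the
   spread of the momenta between two communication rounds have deterministic
   bounds, of order eta tau and rho tau.  With
   a = eta = alpha = beta = gamma = 1/b = T^(-2/3), each of the three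
   estimators u, H, v obeys E|err'|^2 <= (1 - a)^2 E|err|^2 + B a^2: the fresh
   noise is centred given the past, and the projections do not increase the
   distance to the estimated gradients, which lie in the balls.  Hence
   E|err|^2 <= C a for all t.  With r = rho = T^(-1/3), so that a = r^2, the
   averaged momentum then satisfies E|Mbar - grad F(Wbar)| <= C r for all t.
   Smoothness of F, <M, UV^T> >= |M| and |UV^T|^2 <= n give
     F(Wbar') <= F(Wbar) - a |grad F(Wbar)|
                 + a (1 + sqrt n) avg_k |grad F(Wbar) - M^k| + L n a^2,
   and summing over t < T yields the rate, since a T = 1/r.
   UV^T is a measurable function of M because it is the limit of the
   Newton-Schulz iteration started at M/|M|. *)

From HB Require Import structures.
Require Import Defs.
From mathcomp Require Import all_boot all_order all_algebra.
From mathcomp Require Import all_classical all_reals all_analysis.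
From mathcomp Require Import measurable_realfun ring lra zify.
Import Order.TTheory GRing.Theory Num.Theory.
Import numFieldNormedType.Exports.
Local Open Scope classical_set_scope.
Local Open Scope ring_scope.

Set Implicit Arguments.
Unset Strict Implicit.
Unset Printing Implicit Defensive.

(** * Frobenius geometry *)

(** The obstacle is measurability. A run is given outcome by outcome, with the singular value
    decomposition and the projections described only by their properties, so no iterate is known in
    advance to be a random variable. The projections are therefore identified with a closed formula,
    the gradients are obtained as limits of difference quotients, and each iterate is shown to
    depend only on the samples drawn before it. Conditional expectation is replaced by independence
    from the sigma-algebra of earlier draws, followed by Tonelli. The order of drawing matters: [xi]
    comes before [zeta], because [v] is updated at the new [u]. Two estimates shape the constants.
    The recursion for [v] requires the mean squared increment of [u] to be of order a^2, although
    the squared error of [u] is only of order a; the increment is a difference of samples plus a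
    multiple a of noise and error. Moreover the initial [v] is not projected, so the first momentum
    contains a product of two errors, which is absorbed into their squares. The parameter r with T
    r^3 = 1 makes all rates polynomial in r. *)

Definition dotm {R : realType} {p q : nat} (A B : 'M[R]_(p, q)) : R :=
  \sum_i \sum_j A i j * B i j.

Section Frobenius.
Context {R : realType}.
Implicit Types p q r : nat.

Lemma dotmE p q (A B : 'M[R]_(p, q)) : dotm A B = \tr (A^T *m B).
Proof.
rewrite /dotm exchange_big; apply: eq_bigr => j _.
by rewrite mxE; apply: eq_bigr => i _; rewrite mxE.
Qed.

Lemma dotmC p q (A B : 'M[R]_(p, q)) : dotm A B = dotm B A.
Proof. by apply: eq_bigr => i _; apply: eq_bigr => j _; rewrite mulrC. Qed.

Lemma dotmDl p q (A B C : 'M[R]_(p, q)) : dotm (A + B) C = dotm A C + dotm B C.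
Proof. by rewrite !dotmE linearD mulmxDl mxtraceD. Qed.

Lemma dotmZl p q a (A C : 'M[R]_(p, q)) : dotm (a *: A) C = a * dotm A C.
Proof. by rewrite !dotmE linearZ -scalemxAl mxtraceZ. Qed.

Lemma dotmDr p q (A B C : 'M[R]_(p, q)) : dotm C (A + B) = dotm C A + dotm C B.
Proof. by rewrite !(dotmC C) dotmDl. Qed.

Lemma dotmZr p q a (A C : 'M[R]_(p, q)) : dotm C (a *: A) = a * dotm C A.
Proof. by rewrite !(dotmC C) dotmZl. Qed.

Lemma dotmNl p q (A C : 'M[R]_(p, q)) : dotm (- A) C = - dotm A C.
Proof. by rewrite -scaleN1r dotmZl mulN1r. Qed.

Lemma dotmNr p q (A C : 'M[R]_(p, q)) : dotm C (- A) = - dotm C A.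
Proof. by rewrite -scaleN1r dotmZr mulN1r. Qed.

Lemma dotm_sumr p q (I : finType) (A : 'M[R]_(p, q)) (F : I -> 'M[R]_(p, q)) :
  dotm A (\sum_i F i) = \sum_i dotm A (F i).
Proof.
rewrite dotmE linear_sum /= (linear_sum (@mxtrace R q)).
by apply: eq_bigr => i _; rewrite dotmE.
Qed.

Lemma fnorm_ge0 p q (A : 'M[R]_(p, q)) : 0 <= fnorm A.
Proof. exact: sqrtr_ge0. Qed.

Lemma dotm_ge0 p q (A : 'M[R]_(p, q)) : 0 <= dotm A A.
Proof. by do 2!(apply: sumr_ge0 => ? _); rewrite -expr2 sqr_ge0. Qed.

Lemma sqr_fnorm p q (A : 'M[R]_(p, q)) : fnorm A ^+ 2 = dotm A A.
Proof.
rewrite /fnorm sqr_sqrtr; last by do 2!(apply: sumr_ge0 => ? _); rewrite sqr_ge0.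
by apply: eq_bigr => i _; apply: eq_bigr => j _; rewrite expr2.
Qed.

Lemma sqr_fnorm_sum p q (A : 'M[R]_(p, q)) :
  fnorm A ^+ 2 = \sum_i \sum_j A i j ^+ 2.
Proof.
by rewrite sqr_fnorm; apply: eq_bigr => i _; apply: eq_bigr => j _; rewrite expr2.
Qed.

Lemma ler_fnorm_entry p q (A : 'M[R]_(p, q)) i j : `|A i j| <= fnorm A.
Proof.
rewrite -(ler_pXn2r (n:=2)) ?nnegrE ?fnorm_ge0// real_normK ?num_real//.
rewrite sqr_fnorm_sum (bigD1 i)//= (bigD1 j)//= -addrA lerDl addr_ge0//.
  by apply: sumr_ge0 => *; rewrite sqr_ge0.
by do 2!(apply: sumr_ge0 => ? _); rewrite sqr_ge0.
Qed.

Lemma fnorm_eq0 p q (A : 'M[R]_(p, q)) : fnorm A = 0 -> A = 0.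
Proof.
move=> A0; apply/matrixP => i j; rewrite mxE.
by have := ler_fnorm_entry A i j; rewrite A0 normr_le0 => /eqP.
Qed.

Lemma fnorm0 p q : fnorm (0 : 'M[R]_(p, q)) = 0.
Proof.
apply/eqP; rewrite -sqrf_eq0 sqr_fnorm_sum.
by apply/eqP; do 2!(apply: big1 => ? _); rewrite mxE expr0n.
Qed.

Lemma fnormZ p q a (A : 'M[R]_(p, q)) : fnorm (a *: A) = `|a| * fnorm A.
Proof.
apply/eqP; rewrite -(eqrXn2 (n:=2))// ?mulr_ge0 ?fnorm_ge0//; apply/eqP.
by rewrite exprMn real_normK ?num_real// !sqr_fnorm dotmZl dotmZr mulrA expr2.
Qed.

Lemma fnormN p q (A : 'M[R]_(p, q)) : fnorm (- A) = fnorm A.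
Proof. by rewrite -scaleN1r fnormZ normrN1 mul1r. Qed.

Lemma fnormB p q (A B : 'M[R]_(p, q)) : fnorm (A - B) = fnorm (B - A).
Proof. by rewrite -fnormN opprB. Qed.

(** Cauchy-Schwarz: with a = |A| and b = |B|, the square |b A - a B|^2 expands to 2 a b (a b - <A,
    B>). *)
Lemma dotm_le p q (A B : 'M[R]_(p, q)) : dotm A B <= fnorm A * fnorm B.
Proof.
have [/fnorm_eq0 ->|A0] := eqVneq (fnorm A) 0.
  by rewrite -(scale0r A) dotmZl mul0r mulr_ge0 ?fnorm_ge0.
have [/fnorm_eq0 ->|B0] := eqVneq (fnorm B) 0.
  by rewrite -(scale0r B) dotmZr mul0r mulr_ge0 ?fnorm_ge0.
have a0 : 0 < fnorm A by rewrite lt_neqAle eq_sym A0 fnorm_ge0.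
have b0 : 0 < fnorm B by rewrite lt_neqAle eq_sym B0 fnorm_ge0.
have := dotm_ge0 (fnorm B *: A - fnorm A *: B).
rewrite !(dotmDl, dotmDr, dotmNl, dotmNr, dotmZl, dotmZr) -!sqr_fnorm (dotmC B A).
set x := dotm A B; set a := fnorm A in a0 *; set b := fnorm B in b0 * => H.
have {}H : 0 <= (2 * a * b) * (a * b - x).
  by apply: le_trans H _; rewrite le_eqVlt; apply/orP; left; apply/eqP; ring.
by move: H; rewrite pmulr_rge0 ?subr_ge0// !mulr_gt0.
Qed.

Lemma ler_fnormD p q (A B : 'M[R]_(p, q)) : fnorm (A + B) <= fnorm A + fnorm B.
Proof.
rewrite -(ler_pXn2r (n:=2)) ?nnegrE ?addr_ge0 ?fnorm_ge0//.
rewrite sqr_fnorm dotmDl !dotmDr -!sqr_fnorm (dotmC B A).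
by have := dotm_le A B; lra.
Qed.

Lemma ler_fnormB p q (A B : 'M[R]_(p, q)) : fnorm (A - B) <= fnorm A + fnorm B.
Proof. by rewrite -(fnormN B) ler_fnormD. Qed.

Lemma ler_fnorm_trans p q (C A B : 'M[R]_(p, q)) :
  fnorm (A - B) <= fnorm (A - C) + fnorm (C - B).
Proof. by have := ler_fnormD (A - C) (C - B); rewrite addrA subrK. Qed.

Lemma ler_fnorm_sum p q (I : finType) (F : I -> 'M[R]_(p, q)) :
  fnorm (\sum_i F i) <= \sum_i fnorm (F i).
Proof.
elim/big_ind2 : _ => //; first by rewrite fnorm0.
by move=> A a B b Aa Bb; apply: le_trans (ler_fnormD _ _) _; apply: lerD.
Qed.

Lemma sqr_fnormD_le p q (A B : 'M[R]_(p, q)) :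
  fnorm (A + B) ^+ 2 <= 2 * fnorm A ^+ 2 + 2 * fnorm B ^+ 2.
Proof.
rewrite sqr_fnorm dotmDl !dotmDr -!sqr_fnorm (dotmC B A).
have := dotm_le A B; have := sqr_ge0 (fnorm A - fnorm B); lra.
Qed.

Lemma fnorm_mul p q r (A : 'M[R]_(p, q)) (B : 'M[R]_(q, r)) :
  fnorm (A *m B) <= fnorm A * fnorm B.
Proof.
rewrite -(ler_pXn2r (n:=2)) ?nnegrE ?mulr_ge0 ?fnorm_ge0//.
rewrite exprMn !sqr_fnorm_sum mulr_suml; apply: ler_sum => i _.
rewrite (exchange_big (R:=R)) mulr_sumr.
apply: ler_sum => j _.
have := dotm_le (row i A) (col j B)^T.
rewrite /dotm big_ord1 => CS.
have -> : (A *m B) i j = \sum_k row i A 0 k * (col j B)^T 0 k.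
  by rewrite mxE; apply: eq_bigr => k _; rewrite !mxE.
have E1 : \sum_k A i k ^+ 2 = fnorm (row i A) ^+ 2.
  by rewrite sqr_fnorm_sum big_ord1; apply: eq_bigr => k _; rewrite mxE.
have E2 : \sum_k B k j ^+ 2 = fnorm (col j B)^T ^+ 2.
  by rewrite sqr_fnorm_sum big_ord1; apply: eq_bigr => k _; rewrite !mxE.
rewrite E1 E2 -exprMn -[leLHS]real_normK ?num_real//.
rewrite ler_pXn2r ?nnegrE ?mulr_ge0 ?fnorm_ge0// ler_norml CS andbT lerNl.
have := dotm_le (- row i A) (col j B)^T.
by rewrite fnormN dotmNl /dotm big_ord1.
Qed.

End Frobenius.

Section Average.
Context {R : realType} {p q K : nat}.
Hypothesis K0 : (0 < K)%N.
Implicit Types X Y : 'I_K -> 'M[R]_(p, q).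

Lemma avgB X Y : avg X - avg Y = avg (fun k => X k - Y k).
Proof. by rewrite /avg -scalerBr sumrB. Qed.

Lemma avgD X Y : avg X + avg Y = avg (fun k => X k + Y k).
Proof. by rewrite /avg -scalerDr big_split. Qed.

Lemma avgZ a X : a *: avg X = avg (fun k => a *: X k).
Proof. by rewrite /avg scalerA mulrC -scalerA scaler_sumr. Qed.

Lemma avg_cst A : avg (fun _ : 'I_K => A : 'M[R]_(p, q)) = A.
Proof.
rewrite /avg sumr_const card_ord -[A *+ K]scaler_nat scalerA mulVf ?scale1r//.
by rewrite pnatr_eq0 -lt0n.
Qed.

Lemma fnorm_avg X : fnorm (avg X) <= avg (fun k => fnorm (X k) : R^o).
Proof.
rewrite /avg fnormZ ger0_norm ?invr_ge0//.
by apply: ler_wpM2l; rewrite ?invr_ge0// ler_fnorm_sum.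
Qed.

Lemma avg_const (a : R) : avg (fun _ : 'I_K => a : R^o) = a.
Proof.
rewrite /avg sumr_const card_ord -[a *+ K]mulr_natl.
by rewrite /GRing.scale/= mulrA mulVf ?mul1r// pnatr_eq0 -lt0n.
Qed.

Lemma ler_avg (F G : 'I_K -> R) : (forall k, F k <= G k) ->
  avg (F : 'I_K -> R^o) <= avg (G : 'I_K -> R^o).
Proof.
move=> FG; rewrite /avg; apply: ler_wpM2l; rewrite ?invr_ge0//.
exact: ler_sum.
Qed.

Lemma avg_le (F : 'I_K -> R) a : (forall k, F k <= a) -> avg (F : 'I_K -> R^o) <= a.
Proof. by move=> Fa; rewrite -[leRHS]avg_const ler_avg. Qed.

Lemma fnorm_avg_le X a : (forall k, fnorm (X k) <= a) -> fnorm (avg X) <= a.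
Proof. by move=> Xa; apply: le_trans (fnorm_avg _) (avg_le Xa). Qed.

End Average.

Section Kronecker.
Context {R : realType}.

(** Each block v_i I_n has n diagonal entries equal to v_i; every factor sqrt n attached to an
    estimator product comes from here. *)
Lemma sqr_fnorm_kronI (d n : nat) (v : 'cV[R]_d) :
  fnorm (kronI n v) ^+ 2 = n%:R * fnorm v ^+ 2.
Proof.
rewrite !sqr_fnorm dotmE /kronI tr_mxcol mul_mxrow_mxcol (linear_sum (@mxtrace R n)).
rewrite /dotm mulr_sumr; apply: eq_bigr => i _.
rewrite big_ord1 tr_scalar_mx -scalar_mxM /= mxtrace_scalar.
by rewrite -[LHS]mulr_natl.
Qed.

Lemma fnorm_kronI (d n : nat) (v : 'cV[R]_d) :
  fnorm (kronI n v) = Num.sqrt n%:R * fnorm v.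
Proof.
apply/eqP; rewrite -(eqrXn2 (n:=2))// ?mulr_ge0 ?fnorm_ge0 ?sqrtr_ge0//.
by rewrite sqr_fnorm_kronI exprMn [X in _ == X * _]sqr_sqrtr.
Qed.

Lemma kronIB (d n : nat) (v w : 'cV[R]_d) : kronI n v - kronI n w = kronI n (v - w).
Proof. by rewrite /kronI; apply/matrixP => i j; rewrite !mxE mulrnBl. Qed.

Lemma fnorm_mul_kronI (d m n : nat) (H : 'M[R]_(m, \sum_(i < d) n)) (v : 'cV[R]_d) :
  fnorm (H *m kronI n v) <= Num.sqrt n%:R * (fnorm H * fnorm v).
Proof. by apply: le_trans (fnorm_mul _ _) _; rewrite fnorm_kronI mulrCA. Qed.

End Kronecker.

(** * Euclidean projection onto a Frobenius ball *)

Section Projection.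
Context {R : realType}.

(** The factor is 1 inside the ball and C / |A| outside. An explicit formula is what makes the
    projected iterates measurable. *)
Definition proj_ball {p q} (C : R) (A : 'M[R]_(p, q)) : 'M[R]_(p, q) :=
  (C / Num.max C (fnorm A)) *: A.

(** Inside the ball the competitor A itself forces B = A. Outside, the competitor is c A with c = C
    / |A|: c times the minimality inequality plus 1 - c times |B|^2 <= C^2 is exactly |B - c A|^2 <=
    0. *)
Lemma is_projectionE p q C (A B : 'M[R]_(p, q)) : 0 < C ->
  is_projection C A B -> B = proj_ball C A.
Proof.
move=> C0 [BC BA]; rewrite /proj_ball.
have [AC|AC] := leP (fnorm A) C.
  rewrite divff ?gt_eqF// scale1r; apply/eqP; rewrite eq_sym -subr_eq0; apply/eqP.
  apply: fnorm_eq0; apply/eqP; rewrite eq_le fnorm_ge0 andbT.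
  by apply: le_trans (BA _ AC) _; rewrite subrr fnorm0.
have A0 : 0 < fnorm A by apply: lt_trans AC.
set c := C / fnorm A.
have c0 : 0 < c by rewrite divr_gt0.
have c1 : c < 1 by rewrite ltr_pdivrMr ?mul1r.
have cA : c * fnorm A = C by rewrite divfK ?gt_eqF.
apply/eqP; rewrite -subr_eq0; apply/eqP; apply: fnorm_eq0; apply/eqP.
rewrite -sqrf_eq0 eq_le sqr_ge0 andbT.
have := BA (c *: A); rewrite fnormZ gtr0_norm// cA lexx => /(_ isT).
rewrite -{2}(scale1r A) -scalerBl fnormZ ger0_norm ?subr_ge0 ?(ltW c1)// mulrBl mul1r cA.
rewrite -(ler_pXn2r (n:=2)) ?nnegrE ?fnorm_ge0 ?subr_ge0 ?(ltW AC)//.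
rewrite !sqr_fnorm !(dotmDl, dotmDr, dotmNl, dotmNr, dotmZl, dotmZr) -!sqr_fnorm.
rewrite (dotmC B A) -cA; set x := dotm A B; set a := fnorm A => H.
have B2 : fnorm B ^+ 2 <= (c * a) ^+ 2.
  by rewrite cA ler_pXn2r ?nnegrE ?fnorm_ge0// ltW.
have H2 : 0 <= (1 - c) * ((c * a) ^+ 2 - fnorm B ^+ 2).
  by rewrite mulr_ge0 ?subr_ge0// ltW.
have H3 : 0 <= c * ((a - c * a) ^+ 2 - (a ^+ 2 + - x + (- x - - fnorm B ^+ 2))).
  rewrite mulr_ge0 ?(ltW c0)// subr_ge0; apply: le_trans H; lra.
move: H2 H3; nra.
Qed.

Lemma proj_ball_norm p q C (A : 'M[R]_(p, q)) : 0 < C -> fnorm (proj_ball C A) <= C.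
Proof.
move=> C0; have M0 : 0 < Num.max C (fnorm A) by rewrite lt_max C0.
rewrite fnormZ ger0_norm ?divr_ge0 ?(ltW C0) ?(ltW M0)//.
by rewrite mulrAC ler_pdivrMr// ler_pM2l// le_max lexx orbT.
Qed.

(* B is a positive multiple of A with |B| = C when |A| > C, so <A - B, B - Y> >= 0. *)
Lemma proj_ball_nonexp p q C (A Y : 'M[R]_(p, q)) : 0 < C -> fnorm Y <= C ->
  fnorm (proj_ball C A - Y) <= fnorm (A - Y).
Proof.
move=> C0 YC; rewrite /proj_ball; have [AC|AC] := leP (fnorm A) C.
  by rewrite divff ?gt_eqF// scale1r.
have A0 : 0 < fnorm A by apply: lt_trans AC.
set c := C / fnorm A.
have c0 : 0 < c by rewrite divr_gt0.
have c1 : c < 1 by rewrite ltr_pdivrMr ?mul1r.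
have cA : c * fnorm A = C by rewrite divfK ?gt_eqF.
rewrite -(ler_pXn2r (n:=2)) ?nnegrE ?fnorm_ge0//.
rewrite !sqr_fnorm !(dotmDl, dotmDr, dotmNl, dotmNr, dotmZl, dotmZr) -!sqr_fnorm.
rewrite (dotmC Y A); have H := dotm_le A Y.
have {}H : dotm A Y <= fnorm A * (c * fnorm A).
  by apply: le_trans H _; rewrite ler_pM2l// cA.
have : 0 <= (1 - c) * (fnorm A * (c * fnorm A) - dotm A Y).
  by rewrite mulr_ge0 ?subr_ge0// ltW.
have : 0 <= ((1 - c) * fnorm A) ^+ 2 by rewrite sqr_ge0.
nra.
Qed.

End Projection.

(** * The orthogonal factor of a matrix and its approximation by polynomials *)

Section Orthogonalization.
Context {R : realType}.

Lemma fnorm_isometry m n r (U : 'M[R]_(m, r)) (X : 'M[R]_r) (V : 'M[R]_(n, r)) :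
  U^T *m U = 1%:M -> V^T *m V = 1%:M -> fnorm (U *m X *m V^T) = fnorm X.
Proof.
move=> UU VV; apply/eqP; rewrite -(eqrXn2 (n:=2)) ?fnorm_ge0//.
rewrite !sqr_fnorm !dotmE !trmx_mul trmxK !mulmxA mxtrace_mulC !mulmxA.
by rewrite VV mul1mx -(mulmxA X^T) UU mulmx1.
Qed.

Lemma sqr_fnorm_diag r (s : 'rV[R]_r) : fnorm (diag_mx s) ^+ 2 = \sum_i s 0 i ^+ 2.
Proof.
rewrite sqr_fnorm_sum; apply: eq_bigr => i _.
rewrite (bigD1 i)//= mxE eqxx mulr1n big1 ?addr0// => j ji.
by rewrite mxE eq_sym (negbTE ji) mulr0n expr0n.
Qed.

(** |U V^T|^2 is the number r of singular values, and r <= n because V has n rows while V^T V = I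
    has rank r. *)
Lemma orthogonalization_norm m n (M O : 'M[R]_(m, n)) :
  is_orthogonalization M O -> fnorm O <= Num.sqrt n%:R.
Proof.
move=> [r [U [s [V [[UU VV s0 ME] ->]]]]].
rewrite -[U]mulmx1 (fnorm_isometry _ UU VV).
rewrite -(ler_pXn2r (n:=2)) ?nnegrE ?fnorm_ge0 ?sqrtr_ge0//.
rewrite sqr_fnorm sqr_sqrtr// dotmE trmx1 mulmx1 mxtrace1 ler_nat.
have := mxrankM_maxr V^T V; rewrite VV mxrank1 => h.
by apply: leq_trans h _; apply: rank_leq_row.
Qed.

(** The inner product is the sum of the singular values (the nuclear norm), which dominates the root
    of the sum of their squares. *)
Lemma orthogonalization_dotm m n (M O : 'M[R]_(m, n)) :
  is_orthogonalization M O -> fnorm M <= dotm M O.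
Proof.
move=> [r [U [s [V [[UU VV s0 ->] ->]]]]].
rewrite (fnorm_isometry _ UU VV).
have -> : dotm (U *m diag_mx s *m V^T) (U *m V^T) = \sum_i s 0 i.
  rewrite dotmE !trmx_mul trmxK mxtrace_mulC !mulmxA -mxtrace_mulC !mulmxA.
  by rewrite UU mul1mx VV mul1mx tr_diag_mx mxtrace_diag.
have s_ge0 i : 0 <= s 0 i by rewrite ltW.
rewrite -(ler_pXn2r (n:=2)) ?nnegrE ?fnorm_ge0 ?sumr_ge0//.
rewrite sqr_fnorm_diag expr2 mulr_suml; apply: ler_sum => i _.
by rewrite expr2 ler_wpM2l// (bigD1 i)//= lerDl sumr_ge0.
Qed.

(** A cubic polynomial in the entries that keeps U and V and moves each singular value by
    [ns_scalar], for which 1 is an attracting fixed point. *)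
Definition newton_schulz {m n} (X : 'M[R]_(m, n)) : 'M[R]_(m, n) :=
  2^-1 *: (3 *: X - X *m X^T *m X).

Definition ns_scalar (s : R) : R := 2^-1 * (3 * s - s * s * s).

Lemma newton_schulz_svd m n r (U : 'M[R]_(m, r)) (s : 'rV[R]_r) (V : 'M[R]_(n, r)) :
  U^T *m U = 1%:M -> V^T *m V = 1%:M ->
  newton_schulz (U *m diag_mx s *m V^T) = U *m diag_mx (map_mx ns_scalar s) *m V^T.
Proof.
move=> UU VV; rewrite /newton_schulz !trmx_mul trmxK tr_diag_mx.
rewrite -!mulmxA (mulmxA V^T) VV mul1mx (mulmxA U^T) UU mul1mx.
have -> (D : 'M[R]_r) : U *m (D *m (D *m (D *m V^T))) = U *m (D *m D *m D) *m V^T.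
  by rewrite !mulmxA.
rewrite (mulmxA U (diag_mx s)) !mulmx_diag.
rewrite scalemxAl scalemxAr -mulmxBl -mulmxBr scalemxAl scalemxAr.
rewrite (mulmxA U) ; congr (_ *m _ *m _); apply/matrixP => i j; rewrite !mxE.
by rewrite /ns_scalar; case: (i == j); rewrite ?mulr1n ?mulr0n; ring.
Qed.

(** 1 - [ns_scalar s] = (1 - s)^2 (s + 2) / 2, and (1 - s)(s + 2) / 2 = 1 - (s + s^2) / 2 <= 1 - s0
    / 2. The interval [s0, 1] is preserved, so iteration converges geometrically. *)
Lemma ns_scalar_bound (s0 s : R) : 0 < s0 -> s0 <= s <= 1 ->
  s0 <= ns_scalar s <= 1 /\ 1 - ns_scalar s <= (1 - s) * (1 - s0 / 2).
Proof.
move=> h0 /andP[h1 h2]; have s_gt0 : 0 < s by exact: lt_le_trans h1.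
have p1 := ltW s_gt0; have p2 := ltW h0.
have p3 : 0 <= 1 - s by rewrite subr_ge0.
have p4 : 0 <= s - s0 by rewrite subr_ge0.
have h3 := mulr_ge0 p1 p3; have h4 := mulr_ge0 h3 p1; have h6 := mulr_ge0 p3 p3.
have h5 := mulr_ge0 h6 p1; have h7 := mulr_ge0 p3 p4; have h8 := mulr_ge0 p3 p2.
by split; [apply/andP; split|]; rewrite /ns_scalar; nra.
Qed.

Lemma iter_ns_scalar (s : R) : 0 < s <= 1 ->
  (fun k => iter k ns_scalar s) @ \oo --> (1 : R).
Proof.
move=> /andP[s_gt0 s1].
have H k : s <= iter k ns_scalar s <= 1 /\
    1 - iter k ns_scalar s <= (1 - s / 2) ^+ k.
  elim: k => [|k [ih1 ih2]] /=; first by rewrite lexx s1; split=> //; rewrite expr0; lra.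
  have [? ih4] := ns_scalar_bound s_gt0 ih1; split=> //.
  apply: le_trans ih4 _; rewrite exprSr ler_wpM2r//; lra.
apply: (@squeeze_cvgr _ _ _ _ (fun k => 1 - (1 - s / 2) ^+ k) (fun=> 1)).
- near=> k; have [/andP[_ ->] h] := H k; rewrite andbT; lra.
- rewrite -[X in _ --> X]subr0; apply: cvgB; first exact: cvg_cst.
  apply: cvg_expr; rewrite ger0_norm; lra.
- exact: cvg_cst.
Unshelve. all: by end_near. Qed.

Lemma orthogonalization_cvg m n (M O : 'M[R]_(m, n)) i j :
  is_orthogonalization M O ->
  (fun k => iter k newton_schulz ((fnorm M)^-1 *: M) i j) @ \oo --> O i j.
Proof.
move=> [r [U [s [V [[UU VV s0 ME] ->]]]]].
set a := (fnorm M)^-1.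
have E k : iter k newton_schulz (a *: M) =
    U *m diag_mx (map_mx (iter k ns_scalar) (a *: s)) *m V^T.
  elim: k => [|k /= ->].
    rewrite ME /= scalemxAl scalemxAr; congr (_ *m _ *m _).
    by apply/matrixP => x y; rewrite !mxE mulrnAr.
  rewrite newton_schulz_svd//; congr (_ *m diag_mx _ *m _).
  by apply/matrixP => x y; rewrite !mxE.
(* Dividing by |M| brings the singular values into (0, 1], where the scalar iteration converges. For
   M = 0 there are no singular values and the claim is vacuous. *)
have sM l : 0 < (a *: s) 0 l <= 1.
  have : s 0 l <= fnorm M.
    rewrite ME (fnorm_isometry _ UU VV) -(ler_pXn2r (n:=2)) ?nnegrE ?fnorm_ge0 ?(ltW (s0 _))//.
    by rewrite sqr_fnorm_diag (bigD1 l)//= lerDl sumr_ge0// => ? _; rewrite sqr_ge0.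
  move=> h; have M0 : 0 < fnorm M by apply: lt_le_trans h.
  by rewrite mxE mulr_gt0 ?invr_gt0//= mulrC ler_pdivrMr ?mul1r.
have -> : (U *m V^T) i j = \sum_l U i l * 1 * V j l.
  by rewrite mxE; apply: eq_bigr => l _; rewrite mxE mulr1.
have -> : (fun k => iter k newton_schulz (a *: M) i j) =
          (fun k => \sum_l U i l * iter k ns_scalar ((a *: s) 0 l) * V j l).
  apply/funext => k; rewrite E mxE; apply: eq_bigr => l _.
  rewrite mul_mx_diag !mxE; congr (_ * _ * _); by rewrite !mxE.
apply: cvg_big => [x|l _]; first exact: add_continuous.
by apply: cvgM; [apply: cvgM; [exact: cvg_cst|exact: iter_ns_scalar]|exact: cvg_cst].
Qed.

End Orthogonalization.

(** * Gradients and smoothness *)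

Section Gradient.
Context {R : realType}.

Lemma derive_dotm p q (phi : 'M[R]_(p, q) -> R^o) W V :
  differentiable phi W -> 'D_V phi W = dotm (grad phi W) V.
Proof.
move=> dphi; rewrite deriveE// {1}[V]matrix_sum_delta linear_sum.
apply: eq_bigr => i _; rewrite linear_sum; apply: eq_bigr => j _.
by rewrite linearZ/= mxE deriveE// mulrC.
Qed.

Lemma differentiable_entry m n d (G : 'M[R]_(m, n) -> 'cV[R]_d) W i :
  differentiable G W -> differentiable ((fun X => G X i 0) : _ -> R^o) W.
Proof.
move=> dG; apply: (@differentiable_comp _ _ _ _ G (fun v : 'cV[R]_d => v i 0 : R^o)) => //.
exact: differentiable_coord.
Qed.

Lemma diff_entry m n d (G : 'M[R]_(m, n) -> 'cV[R]_d) W i V :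
  differentiable G W ->
  'd ((fun X => G X i 0) : _ -> R^o) W V = 'd G W V i 0.
Proof.
move=> dG.
(* The i-th entry is packaged as a linear map, so that in the chain rule it is its own
   differential. *)
have @f : {linear 'cV[R]_d -> R}.
  by exists (fun N : 'cV[R]_d => N i 0); do 2![eexists]; do ?[constructor];
     rewrite ?mxE// => ? *; rewrite ?mxE//; move=> ?; rewrite !mxE.
have fc : continuous f by exact: coord_continuous.
have df : differentiable f (G W) by exact/linear_differentiable.
have E := congr1 (@^~ V) (@diff_comp _ _ _ _ G f W dG df).
exact: etrans E (congr1 (@^~ ('d G W V)) (diff_lin (G W) fc)).
Qed.

Lemma grad_comp m n d (phi : 'cV[R]_d -> R^o) (G : 'M[R]_(m, n) -> 'cV[R]_d) W :
  differentiable G W -> differentiable phi (G W) ->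
  grad (fun X => phi (G X)) W = jac G W *m kronI n (grad phi (G W)).
Proof.
move=> dG dphi; apply/matrixP => i j.
rewrite /jac /kronI mul_mxrow_mxcol !mxE summxE.
rewrite deriveE; last exact: differentiable_comp.
rewrite (@diff_comp _ _ _ _ G phi)//= -deriveE// derive_dotm//.
rewrite /dotm; apply: eq_bigr => l _; rewrite big_ord1.
by rewrite mul_mx_scalar !mxE -diff_entry// -deriveE//; exact: differentiable_entry.
Qed.

Lemma is_derive_line p q (phi : 'M[R]_(p, q) -> R^o) W V (s : R) :
  differentiable phi (W + s *: V) ->
  is_derive s 1 ((fun x : R => phi (W + x *: V)) : R -> R^o)
    (dotm (grad phi (W + s *: V)) V).
Proof.
move=> dphi; rewrite -derive_dotm//.
have E : (fun h : R => h^-1 *: (((fun x : R => phi (W + x *: V)) \o shift s) (h *: (1 : R^o))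
            - phi (W + s *: V))) =
         (fun h : R => h^-1 *: ((phi \o shift (W + s *: V)) (h *: V) - phi (W + s *: V))).
  apply/funext => h /=; congr (_ *: (phi _ - _)).
  by rewrite [h *: 1]mulr1 scalerDl addrCA.
have dd : derivable phi (W + s *: V) V by exact: diff_derivable.
by split; rewrite /derivable /derive E.
Qed.

(** The mean value theorem on the segment replaces the integral form of the remainder; the price is
    L in place of L / 2. *)
Lemma lipschitz_grad_upper_bound p q (phi : 'M[R]_(p, q) -> R^o) (L : R) W V :
  (forall X, differentiable phi X) ->
  (forall X Y, fnorm (grad phi X - grad phi Y) <= L * fnorm (X - Y)) ->
  0 <= L ->
  phi (W + V) <= phi W + dotm (grad phi W) V + L * fnorm V ^+ 2.
Proof.
move=> dphi Lip L0.
have H (s : R) : is_derive s 1 ((fun x : R => phi (W + x *: V)) : R -> R^o)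
    (dotm (grad phi (W + s *: V)) V) by exact: is_derive_line.
have [] := @MVT R (fun x : R => phi (W + x *: V))
   (fun s => dotm (grad phi (W + s *: V)) V) 0 1 ltr01.
  apply: continuous_subspaceT => x.
  apply: differentiable_continuous; apply/derivable1_diffP.
  by have [] := H x.
move=> s; rewrite in_itv/= => /andP[s0 s1].
rewrite scale1r scale0r addr0 subr0 mulr1 => E.
suff : dotm (grad phi (W + s *: V) - grad phi W) V <= L * fnorm V ^+ 2.
  by rewrite dotmDl dotmNl -E; lra.
apply: le_trans (dotm_le _ _) _; rewrite expr2 mulrA.
apply: ler_wpM2r; first exact: fnorm_ge0.
apply: le_trans (Lip _ _) _; rewrite addrC addKr fnormZ gtr0_norm//.
apply: ler_wpM2l => //; rewrite -[leRHS]mul1r; apply: ler_wpM2r (ltW s1).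
exact: fnorm_ge0.
Qed.

End Gradient.

(** * Measurability of matrix-valued maps *)

(** Entrywise, so that matrix spaces need no sigma-algebra of their own. The domain stays a
    parameter, since it is later equipped with sub-sigma-algebras that express dependence on the
    past. *)
Definition mmeas {disp : measure_display} {T : measurableType disp} {R : realType}
    {p q : nat} (X : T -> 'M[R]_(p, q)) : Prop :=
  forall i j, measurable_fun setT (fun w => X w i j).

Section MatrixMeasurability.
Context {R : realType} {disp : measure_display} {T : measurableType disp}.

Lemma mmeas_cst p q (A : 'M[R]_(p, q)) : mmeas (fun _ : T => A).
Proof. by move=> i j; exact: measurable_cst. Qed.

Lemma mmeasD p q (X Y : T -> 'M[R]_(p, q)) :
  mmeas X -> mmeas Y -> mmeas (fun w => X w + Y w).
Proof.
move=> mX mY i j; under eq_fun do rewrite mxE.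
exact: measurable_funD.
Qed.

Lemma mmeasZ p q (a : T -> R) (X : T -> 'M[R]_(p, q)) :
  measurable_fun setT a -> mmeas X -> mmeas (fun w => a w *: X w).
Proof.
move=> ma mX i j; under eq_fun do rewrite mxE.
exact: measurable_funM.
Qed.

Lemma mmeasZc p q (a : R) (X : T -> 'M[R]_(p, q)) :
  mmeas X -> mmeas (fun w => a *: X w).
Proof. by move=> mX; apply: (mmeasZ (a := cst a)) => //; exact: measurable_cst. Qed.

Lemma mmeasB p q (X Y : T -> 'M[R]_(p, q)) :
  mmeas X -> mmeas Y -> mmeas (fun w => X w - Y w).
Proof.
move=> mX mY; under eq_fun do rewrite -scaleN1r.
by apply: mmeasD => //; exact: mmeasZc.
Qed.

Lemma mmeas_tr p q (X : T -> 'M[R]_(p, q)) : mmeas X -> mmeas (fun w => (X w)^T).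
Proof. by move=> mX i j; under eq_fun do rewrite mxE; exact: mX. Qed.

Lemma mmeas_mul p q r (X : T -> 'M[R]_(p, q)) (Y : T -> 'M[R]_(q, r)) :
  mmeas X -> mmeas Y -> mmeas (fun w => X w *m Y w).
Proof.
move=> mX mY i j; under eq_fun do rewrite mxE.
by apply: measurable_sum => k; exact: measurable_funM.
Qed.

Lemma mmeas_sum p q (I : finType) (X : I -> T -> 'M[R]_(p, q)) :
  (forall k, mmeas (X k)) -> mmeas (fun w => \sum_k X k w).
Proof.
move=> mX i j; under eq_fun do rewrite summxE.
by apply: measurable_sum => k; exact: mX.
Qed.

Lemma mmeas_avg p q K (X : 'I_K -> T -> 'M[R]_(p, q)) :
  (forall k, mmeas (X k)) -> mmeas (fun w => avg (fun k => X k w)).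
Proof. by move=> mX; apply: mmeasZc; exact: mmeas_sum. Qed.

Lemma mmeas_kronI d n (v : T -> 'cV[R]_d) :
  mmeas v -> mmeas (fun w => kronI n (v w)).
Proof.
move=> mv i j; rewrite /kronI; under eq_fun do rewrite !mxE.
case: (_ == _); last by under eq_fun do rewrite mulr0n; exact: measurable_cst.
by under eq_fun do rewrite mulr1n; exact: mv.
Qed.

Lemma measurable_sqr_fnorm p q (X : T -> 'M[R]_(p, q)) :
  mmeas X -> measurable_fun setT (fun w => fnorm (X w) ^+ 2).
Proof.
move=> mX; under eq_fun do rewrite sqr_fnorm_sum.
apply: measurable_sum => i; apply: measurable_sum => j.
by apply: measurable_funX; exact: mX.
Qed.

Lemma measurable_fnorm p q (X : T -> 'M[R]_(p, q)) :
  mmeas X -> measurable_fun setT (fun w => fnorm (X w)).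
Proof.
move=> mX.
have -> : (fun w => fnorm (X w)) = (fun w => (fnorm (X w) ^+ 2) `^ 2^-1).
  apply/funext => w; rewrite powR12_sqrt ?sqr_ge0//.
  by rewrite sqrtr_sqr ger0_norm ?fnorm_ge0.
by apply: (@measurableT_comp _ _ _ _ _ _ (fun x : R => x `^ 2^-1));
  [exact: measurable_powR|exact: measurable_sqr_fnorm].
Qed.

Lemma mmeas_proj_ball p q C (X : T -> 'M[R]_(p, q)) : 0 < C ->
  mmeas X -> mmeas (fun w => proj_ball C (X w)).
Proof.
move=> C0 mX; apply: mmeasZ => //.
apply: measurable_funM; first exact: measurable_cst.
have -> : (fun w => (Num.max C (fnorm (X w)))^-1) =
          (fun w => (Num.max C (fnorm (X w))) `^ (-1)).
  by apply/funext => w; rewrite powR_inv1// le_max (ltW C0).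
apply: (@measurableT_comp _ _ _ _ _ _ (fun x : R => x `^ (-1))).
  exact: measurable_powR.
by apply: measurable_maxr; [exact: measurable_cst|exact: measurable_fnorm].
Qed.

Lemma mmeas_newton_schulz m n k (X : T -> 'M[R]_(m, n)) :
  mmeas X -> mmeas (fun w => iter k newton_schulz (X w)).
Proof.
move=> mX; elim: k => //= k ih.
apply: mmeasZc; apply: mmeasB; first exact: mmeasZc.
by apply: mmeas_mul => //; apply: mmeas_mul => //; exact: mmeas_tr.
Qed.

Lemma mmeas_orthogonalization m n (X O : T -> 'M[R]_(m, n)) :
  mmeas X -> (forall w, is_orthogonalization (X w) (O w)) -> mmeas O.
Proof.
move=> mX XO i j.
apply: (@measurable_fun_cvg _ _ _ _
  (fun k w => iter k newton_schulz ((fnorm (X w))^-1 *: X w) i j)); last first.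
  by move=> w _; exact: orthogonalization_cvg.
move=> k; apply: mmeas_newton_schulz; apply: mmeasZ => //.
have -> : (fun w => (fnorm (X w))^-1) = (fun w => fnorm (X w) `^ (-1)).
  by apply/funext => w; rewrite powR_inv1// fnorm_ge0.
apply: (@measurableT_comp _ _ _ _ _ _ (fun x : R => x `^ (-1))).
  exact: measurable_powR.
exact: measurable_fnorm.
Qed.

End MatrixMeasurability.

(** * Functions continuous in the matrix and measurable in the sample *)

Section Caratheodory.
Context {R : realType} {d1 d2 : measure_display}.
Context {T : measurableType d1} {X : measurableType d2} {p q : nat}.
Variables (W : T -> 'M[R]_(p, q)) (x : T -> X) (phi : 'M[R]_(p, q) -> X -> R).
Hypotheses (mW : mmeas W) (mx : measurable_fun setT x).

Let grid (n : nat) (N : 'M[int]_(p, q)) : 'M[R]_(p, q) :=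
  map_mx (fun k : int => k%:~R / n.+1%:R) N.
Let round (n : nat) (A : 'M[R]_(p, q)) : 'M[int]_(p, q) :=
  map_mx (fun a => Num.floor (a * n.+1%:R)) A.

Let round_err n A i j : `|grid n (round n A) i j - A i j| <= n.+1%:R^-1.
Proof.
rewrite !mxE.
have n0 : 0 < n.+1%:R :> R by rewrite ltr0n.
have /andP[h1 h2] := floor_itv (A i j * n.+1%:R).
rewrite intrD1 in h2.
rewrite -[X in _ - X](mulfK (lt0r_neq0 n0)) -mulrBl normrM.
rewrite [X in _ * X]gtr0_norm ?invr_gt0// -[leRHS]mul1r ler_pM2r ?invr_gt0//.
rewrite ler_norml; lra.
Qed.

Let measurable_round n (N : 'M[int]_(p, q)) :
  measurable [set t | round n (W t) = N].
Proof.
have -> : [set t | round n (W t) = N] =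
    \bigcap_(i in [set: 'I_p]) \bigcap_(j in [set: 'I_q])
      ((fun t => W t i j * n.+1%:R) @^-1` `[(N i j)%:~R, (N i j + 1)%:~R[).
  apply/seteqP; split => t /=.
    move=> <- i _ j _; rewrite /= in_itv/= !mxE; exact: floor_itv.
  move=> h; apply/matrixP => i j; rewrite !mxE; apply: floor_def.
  by have := h i I j I; rewrite /= in_itv.
apply: fin_bigcap_measurable => // i _; apply: fin_bigcap_measurable => // j _.
rewrite -[X in measurable X]setTI.
apply: measurable_funM => //; exact: measurable_cst.
Qed.

(** With the entries of W rounded down to multiples of 1 / (n + 1), the matrix argument takes
    countably many values, so each preimage is a countable union of measurable sets. Continuity in
    the matrix gives the pointwise limit. *)
Lemma measurable_caratheodory :
  (forall y, continuous (phi^~ y)) ->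
  (forall A, measurable_fun setT (phi A)) ->
  measurable_fun setT (fun t => phi (W t) (x t)).
Proof.
move=> cphi mphi.
apply: (@measurable_fun_cvg _ _ _ _ (fun n t => phi (grid n (round n (W t))) (x t))).
  move=> n _ B mB; rewrite setTI.
  have -> : (fun t => phi (grid n (round n (W t))) (x t)) @^-1` B =
    \bigcup_(N : 'M[int]_(p, q)) ([set t | round n (W t) = N] `&`
       (x @^-1` (phi (grid n N) @^-1` B))).
    apply/seteqP; split => t /=; first by move=> Bt; exists (round n (W t)).
    by move=> [N _ [<-]].
  apply: countable_bigcupT_measurable => [|N]; first exact: countableP.
  apply: measurableI; first exact: measurable_round.
  rewrite -[X in measurable X]setTI; apply: mx => //.
  by rewrite -[X in measurable X]setTI; exact: mphi.
move=> t _.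
apply: (@cvg_comp _ _ _ (fun n => grid n (round n (W t))) (phi^~ (x t)) _ (nbhs (W t)));
  last exact: cphi.
apply/cvgrPdist_le => e e0; near=> n.
have [->|] := eqVneq `|W t - grid n (round n (W t))| 0; first exact: ltW.
(* The norm used for convergence is the max norm, so when nonzero it is attained at one entry, where
   the rounding error bound applies. *)
move=> /mx_norm_neq0[[i j]] /= E.
rewrite [leLHS](_ : _ = `|(W t - grid n (round n (W t))) i j|)//.
rewrite [X in `|X|](_ : _ = - (grid n (round n (W t)) i j - W t i j)); last first.
  by rewrite !mxE; ring.
rewrite normrN; apply: le_trans (round_err _ _ _ _) _.
near: n.
have /cvgrPdist_le/(_ e e0) := @cvg_harmonic R.
by apply: filterS => n /=; rewrite sub0r normrN ger0_norm// invr_ge0.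
Unshelve. all: by end_near. Qed.

End Caratheodory.

(** The gradient need not be continuous in the matrix, so the previous lemma is applied not to it
    but to difference quotients with steps 1 / (n + 1). *)
Lemma mmeas_grad {R : realType} {d1 d2 : measure_display}
    {T : measurableType d1} {X : measurableType d2} {p q : nat}
    (W : T -> 'M[R]_(p, q)) (x : T -> X) (phi : 'M[R]_(p, q) -> X -> R) :
  mmeas W -> measurable_fun setT x ->
  (forall y A, differentiable ((phi^~ y) : _ -> R^o) A) ->
  (forall A, measurable_fun setT (phi A)) ->
  mmeas (fun t => grad (phi^~ (x t)) (W t)).
Proof.
move=> mW mx dphi mphi i j.
under eq_fun do rewrite mxE.
have cphi y : continuous (phi^~ y).
  by move=> A; exact: (differentiable_continuous (dphi y A)).
pose h (n : nat) : R := n.+1%:R^-1.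
have h0 n : h n != 0 by rewrite invr_eq0 pnatr_eq0.
have hc : h @ \oo --> (0 : R) by exact: cvg_harmonic.
apply: (@measurable_fun_cvg _ _ _ _
  (fun n t => (h n)^-1 * (phi (h n *: delta_mx i j + W t) (x t) - phi (W t) (x t)))).
  move=> n; apply: measurable_funM; first exact: measurable_cst.
  apply: measurable_funB; last exact: measurable_caratheodory.
  apply: measurable_caratheodory => //.
  by apply: mmeasD => //; exact: mmeas_cst.
move=> t _.
have /cvgr_dnbhsP/(_ h) : derivable ((phi^~ (x t)) : _ -> R^o) (W t) (delta_mx i j).
  exact: diff_derivable.
by apply; split.
Qed.

(** * Independence and expectation bounds *)

Section SigmaOfFamily.
Context {R : realType} {disp : measure_display} {T : measurableType disp}.
Variables (P : probability T R) (I : eqType) (E : I -> set (set T)).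
Hypotheses (Em : forall i A, E i A -> measurable A) (ET : forall i, E i setT).
Hypotheses (EI : forall i, setI_closed (E i)) (ind : mutually_independent P E).

Definition family_sets (S : pred I) : set (set T) := [set A | exists2 i, S i & E i A].

Lemma family_sets_measurable S : family_sets S `<=` measurable.
Proof. by move=> A [i _]; exact: Em. Qed.

(** The pi-system of finite intersections. Padding F with [setT] off J lets two cylinders be
    intersected index by index over the merged list. *)
Let cyl (S : pred I) : set (set T) := [set A | exists (J : seq I) (F : I -> set T),
  [/\ uniq J, all S J, forall j, E j (F j), forall j, j \notin J -> F j = setT &
      A = \bigcap_(j in [set` J]) F j]].

Let cyl_setI S : setI_closed (cyl S).
Proof.
move=> _ _ [J [F [uJ SJ EF FT ->]]] [K [G [uK SK EG GT ->]]].
exists (undup (J ++ K)), (fun j => F j `&` G j); split.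
- exact: undup_uniq.
- by apply/allP => j; rewrite mem_undup mem_cat => /orP[/(allP SJ)|/(allP SK)].
- by move=> j; exact: EI.
- by move=> j; rewrite mem_undup mem_cat negb_or => /andP[/FT -> /GT ->]; rewrite setTI.
apply/seteqP; split => [t [h1 h2] j _|t h].
  split; first by case: (boolP (j \in J)) => [/h1//|/FT ->].
  by case: (boolP (j \in K)) => [/h2//|/GT ->].
by split=> j /= jJ; have [] := h j; rewrite /= ?mem_undup ?mem_cat ?jJ ?orbT.
Qed.

Let cyl_measurable S : cyl S `<=` measurable.
Proof.
move=> _ [J [F [_ _ EF _ ->]]]; apply: fin_bigcap_measurable; first exact: finite_seq.
by move=> j _; exact: Em (EF j).
Qed.

Let sub_cyl S : family_sets S `<=` cyl S.
Proof.
move=> A [i Si EA]; exists [:: i], (fun j => if j == i then A else setT); split => //.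
- by rewrite /= Si.
- by move=> j; case: eqVneq => [->|].
- by move=> j; rewrite inE => /negbTE ->.
- apply/seteqP; split => [t At j|t /(_ i)]; last by rewrite /= inE eqxx; exact.
  by rewrite /= inE => ->.
Qed.

Let cyl_indep S i A B : ~~ S i -> cyl S A -> E i B -> P (A `&` B) = (P A * P B)%E.
Proof.
move=> Si [J [F [uJ SJ EF _ ->]]] EB.
have iJ : i \notin J by apply: contra Si => /(allP SJ).
pose F' j := if j == i then B else F j.
have FF' j : j \in J -> F j = F' j.
  by move=> jJ; rewrite /F'; case: eqVneq jJ iJ => // -> ->.
have -> : (\bigcap_(j in [set` J]) F j) `&` B = \bigcap_(j in [set` i :: J]) F' j.
  apply/seteqP; split => [t [h tB] j|t h].
    rewrite /= inE /F'; case: eqVneq => //= _ jJ; exact: h.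
  split; last by have := h i; rewrite /F' /= inE eqxx; apply.
  by move=> j /= jJ; rewrite FF'//; apply: h; rewrite /= inE jJ orbT.
rewrite (ind (A := F')) /= ?iJ//; last first.
  by move=> j; rewrite /F'; case: eqVneq => [->|_].
rewrite big_cons /F' eqxx muleC; congr (_ * _)%E.
rewrite (ind (A := F))//; apply: eq_big_seq => j jJ.
by have := FF' _ jJ; rewrite /F' => <-.
Qed.

(** The finite measures X -> P (X and B) and X -> P X P B agree on cylinders, whose indices in S
    differ from i, hence on the sigma-algebra they generate. *)
Lemma family_sets_indep S i A B : ~~ S i -> <<s family_sets S >> A -> E i B ->
  P (A `&` B) = (P A * P B)%E.
Proof.
move=> Si SA EB; have mB := Em EB.
have pB0 : (0 <= fine (P B))%R by rewrite fine_ge0.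
pose m1 := mrestr P mB; pose m2 := mscale (NngNum pB0) P.
have m2E X : m2 X = (P X * P B)%E.
  by rewrite /m2 /mscale/= muleC fineK// fin_num_measure.
rewrite -m2E.
apply: (@g_sigma_algebra_measure_unique _ _ _ (cyl S) (@cyl_measurable S) (fun=> setT) _ _ m1 m2).
- move=> _; exists [::], (fun=> setT); split => //.
  by rewrite set_nil bigcap_set0.
- by apply/seteqP; split => // t _; exists 0%N.
- exact: cyl_setI.
- by move=> X cX; apply: etrans (cyl_indep Si cX EB) _; rewrite -m2E.
- move=> _; apply: le_lt_trans (ltry 1); rewrite /m1 /= /mrestr.
  by rewrite setTI probability_le1.
- exact: (sub_sigma_algebra2 (@sub_cyl S) SA).
Qed.

End SigmaOfFamily.

(* Replaces the fresh sample xi by an integration variable, the rest of the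
   integrand depending on the past G only. *)
Section Freezing.
Context {R : realType} {d1 d2 : measure_display}.
Context {T : measurableType d1} {X : measurableType d2}.
Variables (P : probability T R) (D : probability X R) (G : set (set T)) (xi : T -> X).
Hypotheses (GM : G `<=` measurable) (mxi : measurable_fun setT xi).
Hypothesis xi_indep : forall A B, <<s G >> A -> measurable B ->
  P (A `&` xi @^-1` B) = (P A * D B)%E.

(** The outcomes equipped with the sigma-algebra of the past only: a function measurable on [TG] is
    one determined by earlier draws. *)
Local Notation TG := (g_sigma_algebraType G).

Lemma sub_measurable_fun d3 (Y : measurableType d3) (f : T -> Y) :
  measurable_fun [set: TG] (f : TG -> Y) -> measurable_fun setT f.
Proof.
move=> mf _ B mB; have := mf measurableT B mB.
by apply: smallest_sub; [exact: sigma_algebra_measurable|].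
Qed.

Lemma measurable_id_sub : measurable_fun setT (id : T -> TG).
Proof. by apply: sub_measurable_fun; exact: measurable_id. Qed.

(** By [xi_indep] the pair (w, xi w), with w seen in [TG], has the product law on rectangles and
    hence everywhere; Tonelli then separates the integrals. This takes the place of conditional
    expectation. *)
Lemma integral_freeze (phi : TG * X -> \bar R) :
  measurable_fun setT phi -> (forall z, 0 <= phi z)%E ->
  (\int[P]_w phi (w, xi w) = \int[P]_w \int[D]_x phi (w, x))%E.
Proof.
move=> mphi phi0.
pose id_mix := isMeasurableFun.Build _ _ T TG id measurable_id_sub.
pose idG : {mfun T >-> TG} := HB.pack (id : T -> TG) id_mix.
have mpair : measurable_fun setT (fun w : T => ((w, xi w) : TG * X)).
  by apply: measurable_fun_pair => //; exact: measurable_id_sub.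
pose pair_mix := isMeasurableFun.Build _ _ T (TG * X)%type _ mpair.
pose pr : {mfun T >-> (TG * X)%type} := HB.pack (fun w : T => ((w, xi w) : TG * X)) pair_mix.
transitivity (\int[distribution P pr]_z phi z)%E.
  by rewrite ge0_integral_distribution.
transitivity (\int[(distribution P idG \x D)%E]_z phi z)%E.
  apply: eq_measure_integral => A mA _; apply/esym.
  exact: product_measure_unique.
rewrite fubini_tonelli1// ge0_integral_distribution//.
  by apply: measurable_fun_fubini_tonelli_F.
by move=> y; apply: integral_ge0.
Qed.

End Freezing.

(* int f <= s for nonnegative measurable f; the bundled calculus avoids
   carrying integrability proofs. *)
Definition mean_le {disp : measure_display} {T : measurableType disp} {R : realType}
    (P : probability T R) (f : T -> R) (s : R) : Prop :=
  [/\ measurable_fun setT f, forall w, 0 <= f w & (\int[P]_w (f w)%:E <= s%:E)%E].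

Section MeanBounds.
Context {R : realType} {disp : measure_display} {T : measurableType disp}.
Variable P : probability T R.
Implicit Types (f g : T -> R) (a b c : R).

Lemma measurable_EFin_comp (f : T -> R) :
  measurable_fun setT f -> measurable_fun setT (fun w => (f w)%:E).
Proof. by move=> mf; exact/measurable_EFinP. Qed.

Lemma mean_leD f g a b : mean_le P f a -> mean_le P g b ->
  mean_le P (fun w => f w + g w) (a + b).
Proof.
move=> [mf f0 fa] [mg g0 gb]; split.
- exact: measurable_funD.
- by move=> w; exact: addr_ge0.
under eq_integral do rewrite EFinD.
rewrite ge0_integralD//; try exact: measurable_EFin_comp.
- by rewrite EFinD leeD.
- by move=> w _; rewrite lee_fin.
- by move=> w _; rewrite lee_fin.
Qed.

Lemma mean_leZ f a c : 0 <= c -> mean_le P f a -> mean_le P (fun w => c * f w) (c * a).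
Proof.
move=> c0 [mf f0 fa]; split.
- by apply: measurable_funM => //; exact: measurable_cst.
- by move=> w; exact: mulr_ge0.
under eq_integral do rewrite EFinM.
rewrite ge0_integralZl_EFin//; first by rewrite EFinM lee_wpmul2l ?lee_fin.
  by move=> w _; rewrite lee_fin.
exact: measurable_EFin_comp.
Qed.

Lemma mean_le_cst c : 0 <= c -> mean_le P (fun=> c) c.
Proof.
move=> c0; split => //.
by rewrite integral_cst//= probability_setT mule1.
Qed.

Lemma mean_le_mono f g a : measurable_fun setT f -> (forall w, 0 <= f w <= g w) ->
  mean_le P g a -> mean_le P f a.
Proof.
move=> mf fg [mg g0 ga]; split => //; first by move=> w; have /andP[] := fg w.
apply: le_trans ga; apply: ge0_le_integral => //.
- by move=> w _; rewrite lee_fin; have /andP[] := fg w.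
- exact: measurable_EFin_comp.
- exact: measurable_EFin_comp.
- by move=> w _; rewrite lee_fin; have /andP[] := fg w.
Qed.

Lemma mean_leW f a b : a <= b -> mean_le P f a -> mean_le P f b.
Proof.
by move=> ab [mf f0 fa]; split => //; apply: le_trans fa _; rewrite lee_fin.
Qed.

Lemma mean_le_sum n (f : 'I_n -> T -> R) (a : 'I_n -> R) :
  (forall i, mean_le P (f i) (a i)) -> mean_le P (fun w => \sum_i f i w) (\sum_i a i).
Proof.
move=> h.
suff : forall s : seq 'I_n, mean_le P (fun w => \sum_(i <- s) f i w) (\sum_(i <- s) a i).
  exact.
elim=> [|i s ih].
  by rewrite big_nil; under eq_fun do rewrite big_nil; exact: mean_le_cst.
rewrite big_cons; under eq_fun do rewrite big_cons.
exact: mean_leD.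
Qed.

Lemma mean_le_avg n (f : 'I_n -> T -> R) a : (0 < n)%N ->
  (forall i, mean_le P (f i) a) -> mean_le P (fun w => avg (fun i => f i w : R^o)) a.
Proof.
move=> n0 h; have := mean_leZ (c := n%:R^-1) _ (mean_le_sum h).
by rewrite invr_ge0 ler0n sumr_const card_ord -[a *+ n]mulr_natl mulrA mulVf
  ?mul1r ?pnatr_eq0 -?lt0n//; exact.
Qed.

(* |x| <= (s + x^2 / s) / 2 replaces the Jensen inequality. *)
Lemma mean_le_sqrt f a s : 0 < s -> measurable_fun setT f -> (forall w, 0 <= f w) ->
  mean_le P (fun w => f w ^+ 2) a -> mean_le P f (s + s^-1 * a).
Proof.
move=> s0 mf f0 h.
have s'0 : 0 <= s^-1 by rewrite invr_ge0 ltW.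
apply: (mean_le_mono (g := fun w => s + s^-1 * f w ^+ 2)) => //; last first.
  apply: mean_leD; first exact: mean_le_cst (ltW s0).
  exact: mean_leZ.
move=> w; rewrite f0/= -(ler_pM2l s0) mulrDr mulrA mulfV ?gt_eqF// mul1r.
have := sqr_ge0 (s - f w); have := sqr_ge0 (f w); have := sqr_ge0 s; lra.
Qed.

(** Signed counterpart of [mean_le], needed for the cross term of an expanded square. *)
Definition has_int (f : T -> R) (m : R) : Prop :=
  P.-integrable setT (fun w => (f w)%:E) /\ (\int[P]_w (f w)%:E)%E = m%:E.

Lemma has_intD f g a b : has_int f a -> has_int g b ->
  has_int (fun w => f w + g w) (a + b).
Proof.
move=> [fi fa] [gi gb]; split; first exact: (integrableD measurableT fi gi).
by have := integralD_EFin measurableT fi gi; rewrite fa gb -EFinD => <-.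
Qed.

Lemma has_intZ f a c : has_int f a -> has_int (fun w => c * f w) (c * a).
Proof.
move=> [fi fa]; split; first exact: (integrableZl measurableT c fi).
by have := integralZl measurableT fi c; rewrite fa -EFinM => <-.
Qed.

Lemma has_int_cst c : has_int (fun=> c) c.
Proof.
split; last by rewrite integral_cst//= probability_setT mule1.
exact: finite_measure_integrable_cst.
Qed.

Lemma has_int_sum (I : finType) (f : I -> T -> R) (a : I -> R) :
  (forall i, has_int (f i) (a i)) -> has_int (fun w => \sum_i f i w) (\sum_i a i).
Proof.
move=> h.
suff : forall s : seq I, has_int (fun w => \sum_(i <- s) f i w) (\sum_(i <- s) a i).
  exact.
elim=> [|i s ih].
  by rewrite big_nil; under eq_fun do rewrite big_nil; exact: has_int_cst.
rewrite big_cons; under eq_fun do rewrite big_cons.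
exact: has_intD.
Qed.

Lemma has_int_le f g a b : has_int f a -> has_int g b -> (forall w, f w <= g w) -> a <= b.
Proof.
move=> [fi fa] [gi gb] fg; rewrite -lee_fin -fa -gb; apply: le_integral => //.
by move=> w _; rewrite lee_fin.
Qed.

Lemma mean_le_has_int f a : mean_le P f a -> exists2 b, has_int f b & b <= a.
Proof.
move=> [mf f0 fa].
have I0 : (0 <= \int[P]_w (f w)%:E)%E by apply: integral_ge0 => w _; rewrite lee_fin.
have Ifin : (\int[P]_w (f w)%:E)%E \is a fin_num.
  by rewrite ge0_fin_numE//; apply: le_lt_trans fa (ltry _).
exists (fine (\int[P]_w (f w)%:E)%E); last by rewrite -lee_fin fineK.
split; last by rewrite fineK.
apply/integrableP; split; first exact: measurable_EFin_comp.
under eq_integral do rewrite gee0_abs ?lee_fin//.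
by apply: le_lt_trans fa (ltry _).
Qed.

Lemma has_int_mean_le f a : measurable_fun setT f -> (forall w, 0 <= f w) ->
  has_int f a -> mean_le P f a.
Proof. by move=> mf f0 [_ fa]; split => //; rewrite fa. Qed.

Section MatrixMean.
Context {p q : nat}.
Implicit Types (N : T -> 'M[R]_(p, q)) (M A : 'M[R]_(p, q)).

Lemma has_meanP N M : has_mean P N M <-> forall i j, has_int (fun w => N w i j) (M i j).
Proof. by split=> h i j; have [hi hE] := h i j; split => //; move: hE; rewrite unlock. Qed.

Lemma has_mean_mmeas N M : has_mean P N M -> mmeas N.
Proof. by move=> h i j; have [/measurable_int/measurable_EFinP] := h i j. Qed.

Lemma has_meanB N1 N2 M1 M2 : has_mean P N1 M1 -> has_mean P N2 M2 ->
  has_mean P (fun w => N1 w - N2 w) (M1 - M2).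
Proof.
move=> /has_meanP h1 /has_meanP h2; apply/has_meanP => i j.
rewrite !mxE -mulN1r; under eq_fun do rewrite !mxE -mulN1r.
by apply: has_intD => //; exact: has_intZ.
Qed.

Lemma has_meanZ c N M : has_mean P N M -> has_mean P (fun w => c *: N w) (c *: M).
Proof.
move=> /has_meanP h; apply/has_meanP => i j.
by rewrite mxE; under eq_fun do rewrite mxE; exact: has_intZ.
Qed.

Lemma has_mean_cst A : has_mean P (fun=> A) A.
Proof. by apply/has_meanP => i j; exact: has_int_cst. Qed.

Lemma has_mean_dotm A N M : has_mean P N M -> has_int (fun w => dotm A (N w)) (dotm A M).
Proof.
move=> /has_meanP h; apply: has_int_sum => i; apply: has_int_sum => j.
exact: has_intZ.
Qed.

Lemma mean_square_leP N s : mmeas N ->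
  mean_square_le P N s <-> mean_le P (fun w => fnorm (N w) ^+ 2) s.
Proof.
move=> mN; rewrite /mean_square_le unlock; split => [h|[]//]; split => //.
  exact: measurable_sqr_fnorm.
by move=> w; exact: sqr_ge0.
Qed.

(** The cross term 2 <A, N> integrates to 2 <A, 0>, so only the second moment of the noise is
    added. *)
Lemma mean_le_sqr_noise A N s : has_mean P N 0 ->
  mean_le P (fun w => fnorm (N w) ^+ 2) s ->
  mean_le P (fun w => fnorm (A + N w) ^+ 2) (fnorm A ^+ 2 + s).
Proof.
move=> N0 /mean_le_has_int[s' Ns' s's].
have mN := has_mean_mmeas N0.
apply: (mean_leW (a := fnorm A ^+ 2 + 2 * dotm A 0 + s')).
  by rewrite -(scale0r A) dotmZr mul0r mulr0 addr0 lerD2l.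
apply: has_int_mean_le.
- by apply: measurable_sqr_fnorm; apply: mmeasD => //; exact: mmeas_cst.
- by move=> w; exact: sqr_ge0.
have E w : fnorm (A + N w) ^+ 2 = fnorm A ^+ 2 + 2 * dotm A (N w) + fnorm (N w) ^+ 2.
  by rewrite !sqr_fnorm dotmDl !dotmDr (dotmC (N w) A); ring.
under eq_fun do rewrite E.
apply: has_intD => //; apply: has_intD; first exact: has_int_cst.
by apply: has_intZ; exact: has_mean_dotm.
Qed.

(** Jensen for the squared norm: integrate |N|^2 >= 2 <M, N> - |M|^2, which is |N - M|^2 >= 0. *)
Lemma fnorm_mean_le N M s : has_mean P N M ->
  mean_le P (fun w => fnorm (N w) ^+ 2) s -> fnorm M ^+ 2 <= s.
Proof.
move=> NM /mean_le_has_int[s' Ns' s's]; apply: le_trans s's.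
have h : has_int (fun w => 2 * dotm M (N w) + - 1 * fnorm M ^+ 2)
   (2 * dotm M M + - 1 * fnorm M ^+ 2).
  apply: has_intD; first by apply: has_intZ; exact: has_mean_dotm.
  by apply: has_intZ; exact: has_int_cst.
have -> : fnorm M ^+ 2 = 2 * dotm M M + - 1 * fnorm M ^+ 2.
  by rewrite !sqr_fnorm; ring.
apply: has_int_le h Ns' _ => w.
have := dotm_ge0 (N w - M).
rewrite !(dotmDl, dotmDr, dotmNl, dotmNr) -!sqr_fnorm (dotmC M (N w)); lra.
Qed.

End MatrixMean.

End MeanBounds.

Section FreshSample.
Context {R : realType} {d1 d2 : measure_display}.
Context {T : measurableType d1} {X : measurableType d2}.
Variables (P : probability T R) (D : probability X R) (G : set (set T)) (xi : T -> X).
Hypotheses (GM : G `<=` measurable) (mxi : measurable_fun setT xi).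
Hypothesis xi_indep : forall A B, <<s G >> A -> measurable B ->
  P (A `&` xi @^-1` B) = (P A * D B)%E.

Local Notation TG := (g_sigma_algebraType G).

Lemma mean_le_fresh (f : TG * X -> R) (s : T -> R) a :
  measurable_fun setT f -> (forall z, 0 <= f z) ->
  (forall w, mean_le D (fun x => f (w, x)) (s w)) -> mean_le P s a ->
  mean_le P (fun w => f (w, xi w)) a.
Proof.
move=> mf f0 fs [ms s0 sa].
have mpair : measurable_fun setT (fun w : T => ((w, xi w) : TG * X)).
  by apply: measurable_fun_pair => //; exact: measurable_id_sub.
split => //; first exact: (measurableT_comp mf mpair).
rewrite (integral_freeze GM mxi xi_indep (phi := fun z => (f z)%:E))//; last first.
  exact: measurable_EFin_comp.
apply: le_trans sa; apply: ge0_le_integral => //.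
- by move=> w _; apply: integral_ge0 => x _; rewrite lee_fin.
- apply: (sub_measurable_fun GM (f := fun w => (\int[D]_x (f (w, x))%:E)%E)).
  apply: (@measurable_fun_fubini_tonelli_F _ _ TG X R D (fun z => (f z)%:E)).
    exact: measurable_EFin_comp.
  by move=> z; rewrite lee_fin.
- exact: measurable_EFin_comp.
- by move=> w _; have [] := fs w.
Qed.

(** Pythagoras given the past: A is known before the draw and N is centred for every frozen past, so
    second moments add with coefficient 1. A coefficient above 1 on a would destroy the contraction
    of the recursions. *)
Lemma mean_le_fresh_noise p q (A : TG -> 'M[R]_(p, q)) (N : TG * X -> 'M[R]_(p, q))
    (s : T -> R) a b :
  mmeas A -> mmeas N -> (forall w, has_mean D (fun x => N (w, x)) 0) ->
  (forall w, mean_le D (fun x => fnorm (N (w, x)) ^+ 2) (s w)) ->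
  mean_le P s b -> mean_le P (fun w => fnorm (A w) ^+ 2) a ->
  mean_le P (fun w => fnorm (A w + N (w, xi w)) ^+ 2) (a + b).
Proof.
move=> mA mN N0 Ns sb Aa.
apply: (mean_le_fresh (f := fun z => fnorm (A z.1 + N z) ^+ 2)
          (s := fun w => fnorm (A w) ^+ 2 + s w)).
- apply: measurable_sqr_fnorm; apply: mmeasD => // i j.
  exact: (measurableT_comp (mA i j) measurable_fst).
- by move=> z; exact: sqr_ge0.
- by move=> w; exact: (mean_le_sqr_noise (A w) (N0 w) (Ns w)).
- exact: mean_leD.
Qed.

End FreshSample.

(** * Variance-reduced estimators *)

(** Common interface of the samples of g, of its Jacobian and of the gradient of f, so that the
    estimator analysis is done once. Measurability is required over every domain because it is used
    both on past sigma-algebras and on their products with the sample space. *)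
Record oracle {R : realType} {d : measure_display} {X : measurableType d}
    (D : probability X R) {p q p' q' : nat} (phi : 'M[R]_(p, q) -> X -> 'M[R]_(p', q'))
    (Phi : 'M[R]_(p, q) -> 'M[R]_(p', q')) (sigma L : R) : Prop := {
  oracle_meas : forall d' (T : measurableType d') (Y : T -> 'M[R]_(p, q)) (x : T -> X),
    mmeas Y -> measurable_fun setT x -> mmeas (fun t => phi (Y t) (x t));
  oracle_meas_mean : forall d' (T : measurableType d') (Y : T -> 'M[R]_(p, q)),
    mmeas Y -> mmeas (fun t => Phi (Y t));
  oracle_mean : forall Y, has_mean D (phi Y) (Phi Y);
  oracle_var : forall Y, mean_square_le D (fun x => phi Y x - Phi Y) (sigma ^+ 2);
  oracle_lip : forall Y1 Y2,
    mean_square_le D (fun x => phi Y1 x - phi Y2 x) (L ^+ 2 * fnorm (Y1 - Y2) ^+ 2)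
}.

Section Oracle.
Context {R : realType} {d1 d2 : measure_display}.
Context {T : measurableType d1} {X : measurableType d2}.
Variables (P : probability T R) (D : probability X R).
Context {p q p' q' : nat}.
Variables (phi : 'M[R]_(p, q) -> X -> 'M[R]_(p', q')).
Variables (Phi : 'M[R]_(p, q) -> 'M[R]_(p', q')) (sigma L : R).
Hypothesis O : oracle D phi Phi sigma L.

Lemma oracle_noise_mean Y : has_mean D (fun x => phi Y x - Phi Y) 0.
Proof.
by rewrite -(subrr (Phi Y)); apply: has_meanB; [exact: oracle_mean O _|exact: has_mean_cst].
Qed.

Lemma oracle_noise_var Y : mean_le D (fun x => fnorm (phi Y x - Phi Y) ^+ 2) (sigma ^+ 2).
Proof.
by apply/mean_square_leP; [exact: has_mean_mmeas (oracle_noise_mean Y)|exact: oracle_var O Y].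
Qed.

Lemma oracle_diff_mean Y1 Y2 : has_mean D (fun x => phi Y1 x - phi Y2 x) (Phi Y1 - Phi Y2).
Proof. by apply: has_meanB; exact: oracle_mean O _. Qed.

Lemma oracle_diff_var Y1 Y2 : mean_le D (fun x => fnorm (phi Y1 x - phi Y2 x) ^+ 2)
  (L ^+ 2 * fnorm (Y1 - Y2) ^+ 2).
Proof.
apply/mean_square_leP; last exact: oracle_lip O _ _.
exact: has_mean_mmeas (oracle_diff_mean Y1 Y2).
Qed.

Lemma oracle_mean_lip Y1 Y2 : fnorm (Phi Y1 - Phi Y2) <= `|L| * fnorm (Y1 - Y2).
Proof.
rewrite -(ler_pXn2r (n:=2)) ?nnegrE ?mulr_ge0 ?fnorm_ge0//.
rewrite exprMn real_normK ?num_real//.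
exact: fnorm_mean_le (oracle_diff_mean Y1 Y2) (oracle_diff_var Y1 Y2).
Qed.


Section Storm.
Variables (G : set (set T)) (xi : T -> X).
Hypotheses (GM : G `<=` measurable) (mxi : measurable_fun setT xi).
Hypothesis xi_indep : forall A B, <<s G >> A -> measurable B ->
  P (A `&` xi @^-1` B) = (P A * D B)%E.
Local Notation TG := (g_sigma_algebraType G).
Variables (Y Y' : TG -> 'M[R]_(p, q)) (Z : TG -> 'M[R]_(p', q')).
Hypotheses (mY : mmeas Y) (mY' : mmeas Y') (mZ : mmeas Z).
Variables (a e delta : R).
Hypothesis Ze : mean_le P (fun w => fnorm (Z w - Phi (Y w)) ^+ 2) e.
Hypothesis Yd : mean_le P (fun w => fnorm (Y' w - Y w) ^+ 2) delta.

Let storm (w : T) : 'M[R]_(p', q') :=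
  phi (Y' w) (xi w) + (1 - a) *: (Z w - phi (Y w) (xi w)).

Let mphi (V : TG -> 'M[R]_(p, q)) : mmeas V -> mmeas (fun z : TG * X => phi (V z.1) z.2).
Proof.
move=> mV; apply: (oracle_meas O (Y := fun z => V z.1) (x := snd)).
  by move=> i j; exact: (measurableT_comp (mV i j) measurable_fst).
exact: measurable_snd.
Qed.

Let mPhi (V : TG -> 'M[R]_(p, q)) : mmeas V -> mmeas (fun z : TG * X => Phi (V z.1)).
Proof.
move=> mV; apply: (oracle_meas_mean O (Y := fun z : TG * X => V z.1)).
by move=> i j; exact: (measurableT_comp (mV i j) measurable_fst).
Qed.

(** The new error is (1 - a) times the old one plus centred noise, and that noise is the centred
    sample difference plus a times the noise at the old point. Two uses of |x + y|^2 <= 2 |x|^2 + 2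
    |y|^2, with the mean difference bounded like the difference, give the constant 8. *)
Lemma storm_error : mean_le P (fun w => fnorm (storm w - Phi (Y' w)) ^+ 2)
  ((1 - a) ^+ 2 * e + (8 * L ^+ 2 * delta + 2 * a ^+ 2 * sigma ^+ 2)).
Proof.
pose A (w : TG) := (1 - a) *: (Z w - Phi (Y w)).
pose N (z : TG * X) := (phi (Y' z.1) z.2 - Phi (Y' z.1)) -
  (1 - a) *: (phi (Y z.1) z.2 - Phi (Y z.1)).
have N0 w : has_mean D (fun x => N (w, x)) 0.
  rewrite -(subr0 0) -[X in _ - X](scaler0 _ (1 - a)).
  exact: (has_meanB (oracle_noise_mean (Y' w)) (has_meanZ (1 - a) (oracle_noise_mean (Y w)))).
have -> : (fun w => fnorm (storm w - Phi (Y' w)) ^+ 2) =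
    (fun w => fnorm (A w + N (w, xi w)) ^+ 2).
  apply/funext => w; congr (fnorm _ ^+ 2); rewrite /storm /A /N /=.
  by apply/matrixP => i j; rewrite !mxE; ring.
apply: (mean_le_fresh_noise GM mxi xi_indep (A := A) (N := N)
  (s := fun w => 8 * L ^+ 2 * fnorm (Y' w - Y w) ^+ 2 + 2 * a ^+ 2 * sigma ^+ 2)).
- apply: mmeasZc; apply: mmeasB => //; exact: oracle_meas_mean O _ _ _ _.
- apply: mmeasB; first by apply: mmeasB; [exact: mphi|exact: mPhi].
  by apply: mmeasZc; apply: mmeasB; [exact: mphi|exact: mPhi].
- exact: N0.
- move=> w; have dv := oracle_diff_var (Y' w) (Y w); have nv := oracle_noise_var (Y w).
  have nm := oracle_diff_mean (Y' w) (Y w).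
  have lipE := fnorm_mean_le nm dv.
  set l := L ^+ 2 * _ in dv lipE.
  apply: (mean_le_mono (g := fun x => 4 * fnorm (phi (Y' w) x - phi (Y w) x) ^+ 2 +
      (4 * l + 2 * a ^+ 2 * fnorm (phi (Y w) x - Phi (Y w)) ^+ 2))).
  + exact: measurable_sqr_fnorm (has_mean_mmeas (N0 w)).
  + move=> x; rewrite sqr_ge0/=.
    have -> : N (w, x) = ((phi (Y' w) x - phi (Y w) x) - (Phi (Y' w) - Phi (Y w))) +
        a *: (phi (Y w) x - Phi (Y w)).
      by rewrite /N /=; apply/matrixP => i j; rewrite !mxE; ring.
    apply: le_trans (sqr_fnormD_le _ _) _; rewrite fnormZ exprMn real_normK ?num_real//.
    have := sqr_fnormD_le (phi (Y' w) x - phi (Y w) x) (- (Phi (Y' w) - Phi (Y w))).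
    rewrite fnormN; lra.
  + have -> : 8 * L ^+ 2 * fnorm (Y' w - Y w) ^+ 2 + 2 * a ^+ 2 * sigma ^+ 2 =
        4 * l + (4 * l + 2 * a ^+ 2 * sigma ^+ 2) by rewrite /l; ring.
    have l0 : 0 <= l by rewrite /l mulr_ge0 ?sqr_ge0.
    apply: mean_leD; first exact: mean_leZ.
    apply: mean_leD; first by apply: mean_le_cst; rewrite mulr_ge0.
    by apply: mean_leZ => //; rewrite mulr_ge0// sqr_ge0.
- apply: mean_leD; first by apply: mean_leZ => //; rewrite mulr_ge0// sqr_ge0.
  by apply: mean_le_cst; rewrite mulr_ge0 ?sqr_ge0// mulr_ge0 ?sqr_ge0.
- have -> : (fun w => fnorm (A w) ^+ 2) =
      (fun w => (1 - a) ^+ 2 * fnorm (Z w - Phi (Y w)) ^+ 2).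
    by apply/funext => w; rewrite /A fnormZ exprMn real_normK ?num_real.
  by apply: mean_leZ => //; exact: sqr_ge0.
Qed.

(** The increment is the sample difference plus a times (noise minus old error). Hence it is of
    order a^2 in mean square when [delta] is, although e is only of order a. *)
Lemma storm_increment : mean_le P (fun w => fnorm (storm w - Z w) ^+ 2)
  (2 * L ^+ 2 * delta + 4 * a ^+ 2 * sigma ^+ 2 + 4 * a ^+ 2 * e).
Proof.
pose N (z : TG * X) := phi (Y' z.1) z.2 + (1 - a) *: (Z z.1 - phi (Y z.1) z.2) - Z z.1.
have mZ1 : mmeas (fun z : TG * X => Z z.1).
  by move=> i j; exact: (measurableT_comp (mZ i j) measurable_fst).
apply: (mean_le_fresh GM mxi xi_indep (f := fun z => fnorm (N z) ^+ 2)
  (s := fun w => 2 * L ^+ 2 * fnorm (Y' w - Y w) ^+ 2 + 4 * a ^+ 2 * sigma ^+ 2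
     + 4 * a ^+ 2 * fnorm (Z w - Phi (Y w)) ^+ 2)).
- apply: measurable_sqr_fnorm; apply: mmeasB => //; apply: mmeasD; first exact: mphi.
  by apply: mmeasZc; apply: mmeasB => //; exact: mphi.
- by move=> z; exact: sqr_ge0.
- move=> w; have dv := oracle_diff_var (Y' w) (Y w); have nv := oracle_noise_var (Y w).
  apply: (mean_le_mono (g := fun x => 2 * fnorm (phi (Y' w) x - phi (Y w) x) ^+ 2 +
      4 * a ^+ 2 * fnorm (phi (Y w) x - Phi (Y w)) ^+ 2 +
      4 * a ^+ 2 * fnorm (Z w - Phi (Y w)) ^+ 2)).
  + apply: (measurable_sqr_fnorm
      (X := fun x => phi (Y' w) x + (1 - a) *: (Z w - phi (Y w) x) - Z w)).
    apply: mmeasB; last exact: mmeas_cst.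
    apply: mmeasD; first exact: has_mean_mmeas (oracle_mean O _).
    apply: mmeasZc; apply: mmeasB; first exact: mmeas_cst.
    exact: has_mean_mmeas (oracle_mean O _).
  + move=> x; rewrite sqr_ge0/=.
    have -> : N (w, x) = (phi (Y' w) x - phi (Y w) x) +
        a *: ((phi (Y w) x - Phi (Y w)) - (Z w - Phi (Y w))).
      by rewrite /N /=; apply/matrixP => i j; rewrite !mxE; ring.
    apply: le_trans (sqr_fnormD_le _ _) _; rewrite fnormZ exprMn real_normK ?num_real//.
    have := sqr_fnormD_le (phi (Y w) x - Phi (Y w)) (- (Z w - Phi (Y w))).
    rewrite fnormN => h.
    have := ler_wpM2l (sqr_ge0 a) h; lra.
  + apply: mean_leD; last first.
      by apply: mean_le_cst; rewrite mulr_ge0 ?sqr_ge0// mulr_ge0 ?sqr_ge0.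
    apply: mean_leD; first by rewrite -mulrA; exact: mean_leZ.
    by apply: mean_leZ => //; rewrite mulr_ge0// sqr_ge0.
- apply: mean_leD; last by apply: mean_leZ => //; rewrite mulr_ge0// sqr_ge0.
  apply: mean_leD; first by apply: mean_leZ => //; rewrite mulr_ge0// sqr_ge0.
  by apply: mean_le_cst; rewrite mulr_ge0 ?sqr_ge0// mulr_ge0 ?sqr_ge0.
Qed.

End Storm.

Section Batch.
Variables (b : nat) (xs : 'I_b -> T -> X) (Y : T -> 'M[R]_(p, q)).
Hypothesis b0 : (0 < b)%N.
Hypothesis past : forall j : 'I_b, exists G : set (set T),
  [/\ G `<=` measurable, measurable_fun setT (xs j),
      forall A B, <<s G >> A -> measurable B -> P (A `&` xs j @^-1` B) = (P A * D B)%E,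
      mmeas (Y : g_sigma_algebraType G -> _) &
      forall i : 'I_b, (i < j)%N -> measurable_fun setT (xs i : g_sigma_algebraType G -> X)].

(** Martingale argument: each sample is fresh with respect to the partial sum of the earlier ones,
    so the k-th partial sum has second moment at most k sigma^2. The base point Y may be random as
    long as it precedes the batch, as [u_0] does for the batch of [zeta]. *)
Lemma batch_error :
  mean_le P (fun w => fnorm (avg (fun j => phi (Y w) (xs j w)) - Phi (Y w)) ^+ 2)
    (sigma ^+ 2 / b%:R).
Proof.
pose S (k : nat) (w : T) := \sum_(j < b | (j < k)%N) (phi (Y w) (xs j w) - Phi (Y w)).
have HS k : (k <= b)%N -> mean_le P (fun w => fnorm (S k w) ^+ 2) (k%:R * sigma ^+ 2).
  elim: k => [_|k ih kb].
    rewrite mul0r (_ : (fun _ => _) = (fun=> 0)); first exact: mean_le_cst.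
    by apply/funext => w; rewrite /S big_pred0// fnorm0 expr0n.
  pose j := Ordinal kb.
  have [G [GM mj indj mY mpast]] := past j.
  have mS : mmeas (S k : g_sigma_algebraType G -> 'M[R]_(p', q')).
    have -> : S k = (fun w => \sum_(i < b) (if (i < k)%N then phi (Y w) (xs i w) - Phi (Y w) else 0)).
      by apply/funext => w; rewrite /S big_mkcond.
    apply: mmeas_sum => i /=; have [ik|ik] := ltnP i k; last exact: mmeas_cst.
    apply: mmeasB; last exact: oracle_meas_mean O _ _ _ _.
    by apply: (oracle_meas O) => //; exact: mpast.
  pose N (z : g_sigma_algebraType G * X) := phi (Y z.1) z.2 - Phi (Y z.1).
  have -> : (fun w => fnorm (S k.+1 w) ^+ 2) = (fun w => fnorm (S k w + N (w, xs j w)) ^+ 2).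
    apply/funext => w; congr (fnorm _ ^+ 2); rewrite /S (bigD1 j)//= addrC; congr (_ + _).
    by apply: eq_bigl => i; rewrite ltnS -(inj_eq val_inj)/= andbC -ltn_neqAle.
  rewrite -natr1 mulrDl mul1r.
  have mY1 : mmeas (fun z : g_sigma_algebraType G * X => Y z.1).
    by move=> i' j'; exact: (measurableT_comp (mY i' j') measurable_fst).
  apply: (mean_le_fresh_noise GM mj indj (N := N) (s := fun=> sigma ^+ 2)) => //.
  - apply: mmeasB; last exact: oracle_meas_mean O _ _ _ mY1.
    by apply: (oracle_meas O) mY1 _; exact: measurable_snd.
  - by move=> w; exact: (oracle_noise_mean (Y w)).
  - by move=> w; exact: (oracle_noise_var (Y w)).
  - by apply: mean_le_cst; exact: sqr_ge0.
  - by apply: ih; exact: ltnW.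
have -> : sigma ^+ 2 / b%:R = b%:R^-1 ^+ 2 * (b%:R * sigma ^+ 2).
  by field; rewrite pnatr_eq0 -lt0n.
have -> : (fun w => fnorm (avg (fun j => phi (Y w) (xs j w)) - Phi (Y w)) ^+ 2) =
    (fun w => b%:R^-1 ^+ 2 * fnorm (S b w) ^+ 2).
  apply/funext => w; rewrite -{1}(avg_cst b0 (Phi (Y w))) avgB /avg fnormZ exprMn.
  rewrite real_normK ?num_real//; congr (_ * fnorm _ ^+ 2).
  by apply: eq_bigl => j; rewrite ltn_ord.
by apply: mean_leZ; [exact: sqr_ge0|exact: HS].
Qed.

End Batch.

End Oracle.

(** * The compositional objective *)

Section ProblemOracles.
Context {R : realType} {K m n d : nat}.
Variables (pb : problem R K m n d) (c : constants R).
Hypotheses (asm : assumptions pb c) (c_ok : constants_ok c).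

Lemma continuous_entry p q (G : 'M[R]_(p, q) -> 'cV[R]_d) i :
  (forall X, differentiable G X) -> continuous (fun X => G X i 0).
Proof.
move=> dG X; apply: (differentiable_continuous (f := (fun X => G X i 0) : _ -> R^o)).
exact: differentiable_entry.
Qed.

Lemma oracle_gs k : oracle (Dg pb k) (gs pb k) (g pb k) (sigma_g c) (C_g c).
Proof.
split.
- move=> d' T Y x mY mx i j; rewrite (ord1 j).
  apply: (measurable_caratheodory (phi := fun W x => gs pb k W x i 0)) => //.
  + by move=> y; apply: continuous_entry => X; exact: gs_differentiable.
  + by move=> A; exact: gs_measurable.
- move=> d' T Y mY i j; rewrite (ord1 j).
  apply: (measurable_caratheodory (phi := fun W (_ : T) => g pb k W i 0) (x := id)) => //.
  by move=> _; apply: continuous_entry => X; exact: g_differentiable.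
- exact: g_mean.
- exact: gs_variance asm k.
- exact: gs_lipschitz asm k.
Qed.

Lemma mmeas_jac d1 d2 (T : measurableType d1) (X : measurableType d2)
    (G : 'M[R]_(m, n) -> X -> 'cV[R]_d) (W : T -> 'M[R]_(m, n)) (x : T -> X) :
  (forall y A, differentiable (fun V => G V y) A) ->
  (forall A i, measurable_fun setT (fun y => G A y i 0)) ->
  mmeas W -> measurable_fun setT x -> mmeas (fun t => jac (fun V => G V (x t)) (W t)).
Proof.
move=> dG mG mW mx i j; under eq_fun do rewrite mxE.
apply: (mmeas_grad (phi := fun V y => G V y (tagnat.sig1 j) 0)) => // y A.
exact: differentiable_entry.
Qed.

Lemma oracle_grad_gs k :
  oracle (Dg pb k) (fun W x => grad_gs W x) (jac (g pb k)) (sigma_jac_g c) (L_g c).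
Proof.
split.
- move=> d' T Y x mY mx; apply: (mmeas_jac (G := fun V y => gs pb k V y)) => //.
  + by move=> y A; exact: gs_differentiable.
  + by move=> A i; exact: gs_measurable.
- move=> d' T Y mY.
  apply: (mmeas_jac (G := fun V (_ : T) => g pb k V) (x := id)) => //.
  by move=> _ A; exact: g_differentiable.
- exact: grad_gs_mean asm k.
- exact: grad_gs_variance asm k.
- exact: grad_gs_lipschitz asm k.
Qed.

Lemma oracle_grad_fs k :
  oracle (Df pb k) (fun y z => grad_fs y z) (grad (f pb k)) (sigma_f c) (L_f c).
Proof.
split.
- move=> d' T Y x mY mx; apply: (mmeas_grad (phi := fun v z => fs pb k v z)) => //.
  + by move=> z y; exact: fs_differentiable.
  + by move=> y; exact: fs_measurable.
- move=> d' T Y mY.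
  apply: (mmeas_grad (phi := fun v (_ : T) => f pb k v) (x := id)) => //.
  by move=> _ y; exact: f_differentiable.
- exact: grad_fs_mean asm k.
- exact: grad_fs_variance asm k.
- exact: grad_fs_lipschitz asm k.
Qed.

(** Second-moment bounds on samples pass to their mean. The exact Jacobian therefore lies in the
    projection ball, as [proj_ball_nonexp] requires of its target. *)
Lemma jac_g_le k W : fnorm (jac (g pb k) W) <= C_g c.
Proof.
rewrite -(ler_pXn2r (n:=2)) ?nnegrE ?fnorm_ge0 ?(ltW (C_g_gt0 c_ok))//.
have h := grad_gs_mean asm k W.
apply: (fnorm_mean_le h); apply/mean_square_leP; first exact: has_mean_mmeas h.
exact: grad_gs_bound asm k W.
Qed.

Lemma grad_f_le k y : fnorm (grad (f pb k) y) <= C_f c.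
Proof.
rewrite -(ler_pXn2r (n:=2)) ?nnegrE ?fnorm_ge0 ?(ltW (C_f_gt0 c_ok))//.
have h := grad_fs_mean asm k y.
apply: (fnorm_mean_le h); apply/mean_square_leP; first exact: has_mean_mmeas h.
exact: grad_fs_bound asm k y.
Qed.

Lemma g_lip k W1 W2 : fnorm (g pb k W1 - g pb k W2) <= C_g c * fnorm (W1 - W2).
Proof. by rewrite -{1}(gtr0_norm (C_g_gt0 c_ok)); exact: oracle_mean_lip (oracle_gs k) _ _. Qed.

Lemma jac_g_lip k W1 W2 : fnorm (jac (g pb k) W1 - jac (g pb k) W2) <= `|L_g c| * fnorm (W1 - W2).
Proof. exact: oracle_mean_lip (oracle_grad_gs k) _ _. Qed.

Lemma grad_f_lip k y1 y2 : fnorm (grad (f pb k) y1 - grad (f pb k) y2) <= `|L_f c| * fnorm (y1 - y2).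
Proof. exact: oracle_mean_lip (oracle_grad_fs k) _ _. Qed.

Definition client_grad k W : 'M[R]_(m, n) := jac (g pb k) W *m kronI n (grad (f pb k) (g pb k W)).

Lemma differentiable_objective W : differentiable (objective pb : _ -> R^o) W.
Proof.
rewrite (_ : objective pb = K%:R^-1 *: \sum_(k < K) (fun X => f pb k (g pb k X) : R^o)).
  apply: differentiableZ; apply: differentiable_sum => k.
  apply: (@differentiable_comp _ _ _ _ (g pb k) (f pb k : _ -> R^o)).
    exact: g_differentiable.
  exact: f_differentiable.
by apply/funext => X; rewrite /objective /= fct_sumE.
Qed.

Lemma grad_objective W : grad (objective pb) W = avg (fun k => client_grad k W).
Proof.
have dF k X : differentiable ((fun X => f pb k (g pb k X)) : _ -> R^o) X.
  apply: (@differentiable_comp _ _ _ _ (g pb k) (f pb k : _ -> R^o)).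
    exact: g_differentiable.
  exact: f_differentiable.
apply/matrixP => i j; rewrite /avg mxE.
have -> : (objective pb : _ -> R^o) =
    K%:R^-1 *: \sum_(k < K) (fun X => f pb k (g pb k X) : R^o).
  by apply/funext => X; rewrite /objective /= fct_sumE.
rewrite deriveZ; last by apply: derivable_sum => k; exact: diff_derivable.
rewrite derive_sum; last by move=> k; exact: diff_derivable.
rewrite [RHS]mxE summxE; congr (_ * _); apply: eq_bigr => k _.
rewrite /client_grad -grad_comp ?mxE//; first exact: g_differentiable.
exact: f_differentiable.
Qed.

(** The splitting is chosen so that only |v1| and |H2| appear: with the exact gradients as second
    pair, |H2| <= C_g always, and |v1| <= C_f as soon as v1 has been projected. *)
Lemma kron_diff (H1 H2 : 'M[R]_(m, \sum_(i < d) n)) (v1 v2 : 'cV[R]_d) :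
  fnorm (H1 *m kronI n v1 - H2 *m kronI n v2) <=
  Num.sqrt n%:R * (fnorm (H1 - H2) * fnorm v1 + fnorm H2 * fnorm (v1 - v2)).
Proof.
have -> : H1 *m kronI n v1 - H2 *m kronI n v2 =
    (H1 - H2) *m kronI n v1 + H2 *m kronI n (v1 - v2).
  by rewrite -kronIB mulmxBl mulmxBr addrA subrK.
by apply: le_trans (ler_fnormD _ _) _; rewrite mulrDr; apply: lerD; exact: fnorm_mul_kronI.
Qed.

(** The product rule for the Jacobian of g times the gradient of f. Absolute values appear because
    [constants_ok] fixes no sign for [L_g] and [L_f]. *)
Definition smoothness : R :=
  Num.sqrt n%:R * (`|L_g c| * C_f c + C_g c * (`|L_f c| * C_g c)).

Lemma smoothness_ge0 : 0 <= smoothness.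
Proof.
have := ltW (C_g_gt0 c_ok); have := ltW (C_f_gt0 c_ok) => h1 h2.
by rewrite mulr_ge0 ?sqrtr_ge0// addr_ge0// !mulr_ge0.
Qed.

Lemma client_grad_lip k W1 W2 :
  fnorm (client_grad k W1 - client_grad k W2) <= smoothness * fnorm (W1 - W2).
Proof.
apply: le_trans (kron_diff _ _ _ _) _; rewrite /smoothness -mulrA.
apply: ler_wpM2l; first exact: sqrtr_ge0.
rewrite mulrDl; apply: lerD.
  rewrite mulrAC; apply: ler_pM; rewrite ?fnorm_ge0 ?jac_g_lip ?grad_f_le//.
rewrite -!mulrA; apply: ler_pM; rewrite ?fnorm_ge0 ?jac_g_le//.
by apply: le_trans (grad_f_lip _ _ _) _; apply: ler_wpM2l => //; exact: g_lip.
Qed.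

Hypothesis K0 : (0 < K)%N.

Lemma grad_objective_lip W1 W2 :
  fnorm (grad (objective pb) W1 - grad (objective pb) W2) <= smoothness * fnorm (W1 - W2).
Proof.
by rewrite !grad_objective avgB; apply: (fnorm_avg_le K0) => k; exact: client_grad_lip.
Qed.

Lemma objective_descent W V :
  objective pb (W + V) <=
  objective pb W + dotm (grad (objective pb) W) V + smoothness * fnorm V ^+ 2.
Proof.
apply: lipschitz_grad_upper_bound; last exact: smoothness_ge0.
- exact: differentiable_objective.
- exact: grad_objective_lip.
Qed.

End ProblemOracles.
Arguments smoothness {R} n c.

(** * Filtration of the samples and consensus *)

Lemma sub_g_sigma_measurable {T : pointedType} (G G' : set (set T)) d (Y : measurableType d)
    (f : T -> Y) : G `<=` G' ->
  measurable_fun setT (f : g_sigma_algebraType G -> Y) ->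
  measurable_fun setT (f : g_sigma_algebraType G' -> Y).
Proof.
move=> GG' mf _ B mB; have := mf measurableT B mB.
exact: (sub_sigma_algebra2 GG').
Qed.

Section Filtration.
Context {R : realType} {K m n d b : nat} {pb : problem R K m n d}.
Context {disp : measure_display} {Omega : measurableType disp}.
Variables (P : probability Omega R).
Variables (xi : forall k, slot b -> Omega -> spg pb k).
Variables (zeta : forall k, slot b -> Omega -> spf pb k).
Hypothesis smp : is_sampling P xi zeta.

Let index : eqType := ((('I_K * ('I_b + nat)) + ('I_K * ('I_b + nat)))%type : eqType).

Definition sample_events (i : index) : set (set Omega) :=
  match i with
  | inl (k, s) => preimage_set_system setT (xi k s) measurable
  | inr (k, s) => preimage_set_system setT (zeta k s) measurable
  end.

(* Position in the order of drawing: both batches, then xi and zeta alternately.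
   A sample is independent of the samples of smaller rank. *)
Definition rank_xi (s : slot b) : nat :=
  match s with inl j => j | inr t => (2 * b + 2 * t)%N end.
Definition rank_zeta (s : slot b) : nat :=
  match s with inl j => (b + j)%N | inr t => (2 * b + 2 * t + 1)%N end.
Definition rank (i : index) : nat :=
  match i with inl (_, s) => rank_xi s | inr (_, s) => rank_zeta s end.

Definition past (r : nat) : set (set Omega) :=
  family_sets sample_events (fun i => (rank i < r)%N).

Local Notation Om r := (g_sigma_algebraType (past r)).

Lemma sample_events_measurable i A : sample_events i A -> measurable A.
Proof.
case: i => -[k s] [B mB <-]; [exact: (xi_measurable smp)|exact: (zeta_measurable smp)].
Qed.

Lemma past_measurable r : past r `<=` measurable.
Proof. exact: family_sets_measurable sample_events_measurable _. Qed.

Lemma past_mono r r' : (r <= r')%N -> past r `<=` past r'.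
Proof. by move=> rr' A [i ri iA]; exists i => //; exact: leq_trans rr'. Qed.

Lemma mmeas_past p q (X : Omega -> 'M[R]_(p, q)) r r' : (r <= r')%N ->
  mmeas (X : Om r -> _) -> mmeas (X : Om r' -> _).
Proof. by move=> rr' mX i j; exact: sub_g_sigma_measurable (past_mono rr') (mX i j). Qed.

Lemma mmeas_Omega p q (X : Omega -> 'M[R]_(p, q)) r : mmeas (X : Om r -> _) -> mmeas X.
Proof.
move=> mX i j.
exact: (sub_measurable_fun (@past_measurable r) (f := fun w => X w i j) (mX i j)).
Qed.

Lemma xi_past k s r : (rank_xi s < r)%N -> measurable_fun setT (xi k s : Om r -> spg pb k).
Proof.
move=> sr _ B mB; apply: sub_sigma_algebra; exists (inl (k, s)) => //.
by exists B.
Qed.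

Lemma zeta_past k s r : (rank_zeta s < r)%N -> measurable_fun setT (zeta k s : Om r -> spf pb k).
Proof.
move=> sr _ B mB; apply: sub_sigma_algebra; exists (inr (k, s)) => //.
by exists B.
Qed.

Lemma preimage_set_system_setI d' (Y : measurableType d') (f : Omega -> Y) :
  setI_closed (preimage_set_system setT f measurable).
Proof.
move=> _ _ [A mA <-] [B mB <-]; exists (A `&` B); first exact: measurableI.
by rewrite preimage_setI !setTI.
Qed.

Lemma past_indep i A B : <<s past (rank i) >> A -> sample_events i B ->
  P (A `&` B) = (P A * P B)%E.
Proof.
apply: (family_sets_indep (E := sample_events)).
- exact: sample_events_measurable.
- by case=> -[k s]; exists setT; rewrite ?setTI.
- by case=> -[k s]; exact: preimage_set_system_setI.
- exact: samples_independent smp.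
- by rewrite ltnn.
Qed.

Lemma xi_fresh k s A B : <<s past (rank_xi s) >> A -> measurable B ->
  P (A `&` xi k s @^-1` B) = (P A * Dg pb k B)%E.
Proof.
move=> sA mB; rewrite (@past_indep (inl (k, s)))//; last by exists B; rewrite ?setTI.
by rewrite (xi_law smp).
Qed.

Lemma zeta_fresh k s A B : <<s past (rank_zeta s) >> A -> measurable B ->
  P (A `&` zeta k s @^-1` B) = (P A * Df pb k B)%E.
Proof.
move=> sA mB; rewrite (@past_indep (inr (k, s)))//; last by exists B; rewrite ?setTI.
by rewrite (zeta_law smp).
Qed.

End Filtration.

(** * Linear recursions averaged every [tau] steps, covering both the iterates and the momenta *)

Section Consensus.
Context {R : realType} {K p q : nat}.
Hypothesis K0 : (0 < K)%N.
Variables (tau : nat) (cf z : R) (X Z : nat -> 'I_K -> 'M[R]_(p, q)).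
Hypotheses (tau1 : (1 <= tau)%N) (cf01 : 0 <= cf <= 1) (z0 : 0 <= z).
Hypothesis Zz : forall t k, fnorm (Z t k) <= z.
Hypothesis X0 : forall k, X 0%N k = avg (X 0%N).
Hypothesis XS : forall t k, X t.+1 k =
  if (tau %| t.+1)%N then avg (fun j => cf *: X t j + Z t j) else cf *: X t k + Z t k.

(** Averaging commutes with the linear update, so the mean follows the same recursion whether or not
    communication takes place. *)
Lemma consensus_avg t : avg (X t.+1) = cf *: avg (X t) + avg (Z t).
Proof.
rewrite avgZ avgD; case: (boolP (tau %| t.+1)%N) => ht.
  rewrite (_ : X t.+1 = fun=> avg (fun j => cf *: X t j + Z t j)) ?avg_cst//.
  by apply/funext => k; rewrite XS ht.
by congr avg; apply/funext => k; rewrite XS (negbTE ht).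
Qed.

(* The deviation grows by at most 2z between two communication rounds. *)
Lemma consensus_error t k : fnorm (X t k - avg (X t)) <= (t %% tau)%:R * (2 * z).
Proof.
elim: t k => [|t ih] k; first by rewrite -(X0 k) subrr fnorm0 mod0n mul0r.
rewrite consensus_avg XS; case: ifPn => ht.
  by rewrite -avgD -avgZ subrr fnorm0 mulr_ge0// mulr_ge0.
(* The residue cannot wrap around: t mod tau = tau - 1 would make t + 1 a communication round. *)
have -> : (t.+1 %% tau = (t %% tau).+1)%N.
  have tp : (0 < tau)%N by [].
  have := ltn_pmod t tp; rewrite leq_eqVlt => /orP[/eqP h|h].
    move: ht; rewrite (divn_eq t tau) -addnS h dvdn_addr ?dvdn_mull//.
    by rewrite dvdnn.
  by rewrite -addn1 -modnDml addn1 modn_small.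
rewrite opprD addrACA -scalerBr -natr1 mulrDl mul1r.
apply: le_trans (ler_fnormD _ _) _; apply: lerD.
  rewrite fnormZ; have /andP[c0 c1] := cf01; rewrite ger0_norm//.
  by apply: le_trans (ih k); rewrite ler_piMl ?fnorm_ge0.
rewrite mulr2n mulrDl mul1r; apply: le_trans (ler_fnormB _ _) _.
by apply: lerD; [exact: Zz|apply: (fnorm_avg_le K0)].
Qed.

Lemma consensus_error_le tau0 t k : (tau <= tau0)%N ->
  fnorm (X t k - avg (X t)) <= 2 * tau0%:R * z.
Proof.
move=> h; apply: le_trans (consensus_error _ _) _.
rewrite mulrA [2 * _]mulrC; apply: ler_wpM2r => //; apply: ler_wpM2r => //.
by rewrite ler_nat; apply: leq_trans h; apply/ltnW/ltn_pmod.
Qed.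

End Consensus.

(** * Error recursions along a run *)

Section RunConstants.
Context {R : realType}.
Variables (n tau0 : nat) (c : constants R).

(* With a = r^2: a omega bounds |W' - W| for each client; err_u a, err_H a and
   err_v a bound E|u - g(W)|^2, E|H - grad g(W)|^2 and E|v - grad f(u)|^2;
   incr_u a^2 bounds E|u' - u|^2; err_est r bounds the resulting error of
   H (v (x) I); err_Mbar r and err_M r bound the mean distances of grad F(Wbar)
   to Mbar and to each M^k. *)
Definition omega : R := Num.sqrt n%:R * (4 * tau0%:R + 1).
Definition err_u : R := 8 * C_g c ^+ 2 * omega ^+ 2 + 3 * sigma_g c ^+ 2.
Definition err_H : R := 8 * L_g c ^+ 2 * omega ^+ 2 + 3 * sigma_jac_g c ^+ 2.
Definition incr_u : R := 2 * C_g c ^+ 2 * omega ^+ 2 + 4 * sigma_g c ^+ 2 + 4 * err_u.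
Definition err_v : R := 8 * L_f c ^+ 2 * incr_u + 3 * sigma_f c ^+ 2.
Definition err_est : R := Num.sqrt n%:R *
  (C_f c * (1 + err_H) + C_g c * ((1 + err_v) + `|L_f c| * (1 + err_u))).
Definition err_Mbar : R :=
  smoothness n c * (2 * omega) + Num.sqrt n%:R * (err_H + err_v) + err_est.
Definition err_M : R := err_Mbar + 2 * tau0%:R * (Num.sqrt n%:R * (C_g c * C_f c)).
Definition rate_const (gap : R) : R :=
  gap + (1 + Num.sqrt n%:R) * err_M + smoothness n c * n%:R.

Lemma omega_ge0 : 0 <= omega.
Proof. by rewrite mulr_ge0 ?sqrtr_ge0// addr_ge0// mulr_ge0. Qed.

Lemma mul_sqr2_ge0 (x y z : R) : 0 <= x -> 0 <= x * y ^+ 2 * z ^+ 2.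
Proof. by move=> x0; rewrite mulr_ge0 ?sqr_ge0// mulr_ge0 ?sqr_ge0. Qed.

Lemma mul_sqr_ge0 (x y : R) : 0 <= x -> 0 <= x * y ^+ 2.
Proof. by move=> x0; rewrite mulr_ge0 ?sqr_ge0. Qed.

Lemma err_u_ge0 : 0 <= err_u.
Proof. by rewrite addr_ge0 ?mul_sqr2_ge0 ?mul_sqr_ge0. Qed.

Lemma err_H_ge0 : 0 <= err_H.
Proof. by rewrite addr_ge0 ?mul_sqr2_ge0 ?mul_sqr_ge0. Qed.

Lemma incr_u_ge0 : 0 <= incr_u.
Proof.
by rewrite addr_ge0 ?(mulr_ge0 _ err_u_ge0)// addr_ge0 ?mul_sqr2_ge0 ?mul_sqr_ge0.
Qed.

Lemma err_v_ge0 : 0 <= err_v.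
Proof.
by rewrite addr_ge0 ?mul_sqr_ge0// mulr_ge0 ?incr_u_ge0// mul_sqr_ge0.
Qed.

End RunConstants.

(* C a is a supersolution of the error recursion e' = (1 - a)^2 e + B a^2. *)
Lemma storm_fixpoint (R : realType) (a B C : R) : 0 <= a <= 1 -> B <= C -> 0 <= C ->
  (1 - a) ^+ 2 * (C * a) + B * a ^+ 2 <= C * a.
Proof.
move=> /andP[a0 a1] BC C0.
have h1 : 0 <= (C - B) * (a * a) by rewrite !mulr_ge0 ?subr_ge0.
have h2 : 0 <= (C * a) * (a * (1 - a)) by rewrite !mulr_ge0 ?subr_ge0.
have h3 : 0 <= (C * a) * (1 - a) by rewrite !mulr_ge0 ?subr_ge0.
nra.
Qed.

Lemma draw_bounds (b t : nat) :
  [/\ (2 * b + 2 * t < 2 * b + 2 * t + 1)%N, (2 * b + 2 * t + 1 < 2 * b + 2 * t.+1)%N &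
      (2 * b + 2 * t < 2 * b + 2 * t.+1)%N].
Proof. by split; lia. Qed.

Lemma batch_bounds (b j : nat) : (j < b)%N ->
  [/\ (b <= 2 * b + 2 * 0)%N, (j < 2 * b + 2 * 0)%N & (b + j < 2 * b + 2 * 0)%N].
Proof. by move=> jb; split; lia. Qed.

Section Trajectory.
Context {R : realType} {K m n d b : nat} {pb : problem R K m n d} {c : constants R}.
Context {disp : measure_display} {Omega : measurableType disp}.
Variables (P : probability Omega R).
Variables (xi : forall k, slot b -> Omega -> spg pb k).
Variables (zeta : forall k, slot b -> Omega -> spf pb k).
Variables (W0 : 'M[R]_(m, n)) (r : R) (tau tau0 : nat).
Hypotheses (asm : assumptions pb c) (c_ok : constants_ok c) (K0 : (0 < K)%N).
Hypotheses (smp : is_sampling P xi zeta) (r01 : 0 < r <= 1).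
Hypotheses (bE : b%:R^-1 = r ^+ 2) (tau1 : (1 <= tau)%N) (tau_le : (tau <= tau0)%N).
Let a : R := r ^+ 2.
Variables (W M orth : nat -> 'I_K -> Omega -> 'M[R]_(m, n)).
Variables (u v : nat -> 'I_K -> Omega -> 'cV[R]_d).
Variable (H : nat -> 'I_K -> Omega -> 'M[R]_(m, \sum_(i < d) n)).
Hypothesis orthP : forall t w k, is_orthogonalization (M t k w) (orth t k w).
(* The coefficient 1 brings W to the form required by consensus_error. *)
Hypothesis W_S : forall t w k, W t.+1 k w =
  if (tau %| t.+1)%N then avg (fun j => 1 *: W t j w + (- a) *: orth t j w)
  else 1 *: W t k w + (- a) *: orth t k w.
Hypothesis u_S : forall t w k, u t.+1 k w = gs pb k (W t.+1 k w) (xi k (inr t) w) +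
  (1 - a) *: (u t k w - gs pb k (W t k w) (xi k (inr t) w)).
Hypothesis v_S : forall t w k, v t.+1 k w = proj_ball (C_f c)
  (grad_fs (u t.+1 k w) (zeta k (inr t) w) +
    (1 - a) *: (v t k w - grad_fs (u t k w) (zeta k (inr t) w))).
Hypothesis H_S : forall t w k, H t.+1 k w = proj_ball (C_g c)
  (grad_gs (W t.+1 k w) (xi k (inr t) w) +
    (1 - a) *: (H t k w - grad_gs (W t k w) (xi k (inr t) w))).
Hypothesis M_S : forall t w k, M t.+1 k w =
  if (tau %| t.+1)%N
  then avg (fun j => (1 - r) *: M t j w + r *: (H t.+1 j w *m kronI n (v t.+1 j w)))
  else (1 - r) *: M t k w + r *: (H t.+1 k w *m kronI n (v t.+1 k w)).
Hypothesis W_0 : forall w k, W 0 k w = W0.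
Hypothesis u_0 : forall w k, u 0 k w = avg (fun j => gs pb k W0 (xi k (inl j) w)).
Hypothesis H_0 : forall w k, H 0 k w = avg (fun j => grad_gs W0 (xi k (inl j) w)).
Hypothesis v_0 : forall w k, v 0 k w = avg (fun j => grad_fs (u 0 k w) (zeta k (inl j) w)).
Hypothesis M_0 : forall w k, M 0 k w = avg (fun j => H 0 j w *m kronI n (v 0 j w)).

Local Notation Om q := (g_sigma_algebraType (past xi zeta q)).

Let r0 : 0 < r. Proof. by have /andP[] := r01. Qed.
Let r1 : r <= 1. Proof. by have /andP[] := r01. Qed.
Let a0 : 0 < a. Proof. exact: exprn_gt0. Qed.
Let a1 : a <= 1. Proof. by rewrite /a exprn_ile1// ltW. Qed.
Let ar : a <= r. Proof. by rewrite /a expr2 ler_piMl// ltW. Qed.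
Let a01 : 0 <= a <= 1. Proof. by rewrite (ltW a0). Qed.
Let b0 : (0 < b)%N.
Proof.
(* The inverse of 0 is 0, so an empty batch would force a = 0. *)
rewrite lt0n; apply/eqP => bb; have := a0.
by rewrite /a -bE bb invr0 ltxx.
Qed.
Let Cg0 : 0 <= C_g c. Proof. exact/ltW/C_g_gt0. Qed.
Let Cf0 : 0 <= C_f c. Proof. exact/ltW/C_f_gt0. Qed.
Let sn : R := Num.sqrt n%:R.
Let sn0 : 0 <= sn. Proof. exact: sqrtr_ge0. Qed.
Let om := omega n tau0 : R.
Let L := smoothness n c.
Let L0 : 0 <= L. Proof. exact: smoothness_ge0. Qed.

(** * Deterministic bounds along the run *)

Let v_le t w k : fnorm (v t.+1 k w) <= C_f c.
Proof. by rewrite v_S; apply: proj_ball_norm; exact: C_f_gt0. Qed.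
Let H_le t w k : fnorm (H t.+1 k w) <= C_g c.
Proof. by rewrite H_S; apply: proj_ball_norm; exact: C_g_gt0. Qed.

Let orth_le t w k : fnorm ((- a) *: orth t k w) <= a * sn.
Proof.
rewrite fnormZ normrN gtr0_norm//; apply: ler_wpM2l; first exact: ltW.
exact: orthogonalization_norm (orthP t w k).
Qed.

Let HV_le t w k : fnorm (r *: (H t.+1 k w *m kronI n (v t.+1 k w))) <=
  r * (sn * (C_g c * C_f c)).
Proof.
rewrite fnormZ gtr0_norm//; apply: ler_wpM2l; first exact: ltW.
apply: le_trans (fnorm_mul_kronI _ _) _; apply: ler_wpM2l => //.
by apply: ler_pM; rewrite ?fnorm_ge0.
Qed.

Let Wbar t w := avg ((W t)^~ w).
Let Mbar t w := avg ((M t)^~ w).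

Let asn0 : 0 <= a * sn. Proof. by rewrite mulr_ge0// ltW. Qed.

Let W_cons t w k : fnorm (W t k w - Wbar t w) <= 2 * tau0%:R * (a * sn).
Proof.
apply: (consensus_error_le K0 (cf := 1) (X := fun t k => W t k w)
  (Z := fun t k => (- a) *: orth t k w) tau1) => //.
- by rewrite ler01 lexx.
- by move=> j; rewrite W_0 (_ : (W 0)^~ w = fun=> W0) ?avg_cst//; apply/funext => i; rewrite W_0.
Qed.

Let M_cons t w k : fnorm (M t k w - Mbar t w) <= 2 * tau0%:R * (r * (sn * (C_g c * C_f c))).
Proof.
apply: (consensus_error_le K0 (cf := 1 - r) (X := fun t k => M t k w)
  (Z := fun t k => r *: (H t.+1 k w *m kronI n (v t.+1 k w))) tau1) => //.
- by rewrite subr_ge0 r1/= gerBl ltW.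
- by rewrite !mulr_ge0// ltW.
- move=> j; rewrite M_0.
  rewrite (_ : (M 0)^~ w = fun=> avg (fun j => H 0 j w *m kronI n (v 0 j w))) ?avg_cst//.
  by apply/funext => i; rewrite M_0.
Qed.

Let Wbar_S t w : Wbar t.+1 w = Wbar t w + avg (fun k => (- a) *: orth t k w).
Proof.
have := @consensus_avg _ _ _ _ K0 tau 1 (fun t k => W t k w)
  (fun t k => (- a) *: orth t k w) (fun s => W_S s w) t.
by rewrite scale1r.
Qed.

Let Mbar_S t w : Mbar t.+1 w = (1 - r) *: Mbar t w +
  avg (fun k => r *: (H t.+1 k w *m kronI n (v t.+1 k w))).
Proof.
exact: (@consensus_avg _ _ _ _ K0 tau (1 - r) (fun t k => M t k w)
  (fun t k => r *: (H t.+1 k w *m kronI n (v t.+1 k w))) (fun s => M_S s w) t).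
Qed.

Let Wbar_incr t w : fnorm (Wbar t.+1 w - Wbar t w) <= a * sn.
Proof. by rewrite Wbar_S addrC addKr; apply: (fnorm_avg_le K0). Qed.

(** Passing through the two averages costs 2 tau0 + 1 + 2 tau0 steps of length a sqrt n, whence 4
    tau0 + 1 in [omega]. *)
Let W_incr t w k : fnorm (W t.+1 k w - W t k w) <= a * om.
Proof.
have h1 := W_cons t.+1 w k; have h2 := W_cons t w k; have h3 := Wbar_incr t w.
apply: le_trans (ler_fnorm_trans (Wbar t.+1 w) _ _) _.
apply: le_trans (lerD h1 (ler_fnorm_trans (Wbar t w) _ _)) _.
rewrite (fnormB (Wbar t w)) /om /omega -/sn; lra.
Qed.

Let W_incr2 t w k : fnorm (W t.+1 k w - W t k w) ^+ 2 <= om ^+ 2 * a ^+ 2.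
Proof.
have aom : 0 <= a * om by rewrite mulr_ge0 ?(ltW a0)// omega_ge0.
by rewrite -exprMn mulrC ler_pXn2r ?nnegrE ?fnorm_ge0.
Qed.

(** * Dependence of the state on the past samples *)

Let state_meas t := forall k,
  [/\ mmeas (W t k : Om (2 * b + 2 * t) -> _), mmeas (u t k : Om (2 * b + 2 * t) -> _),
      mmeas (v t k : Om (2 * b + 2 * t) -> _), mmeas (H t k : Om (2 * b + 2 * t) -> _) &
      mmeas (M t k : Om (2 * b + 2 * t) -> _)].

Let meas_orth t : state_meas t -> forall k, mmeas (orth t k : Om (2 * b + 2 * t) -> _).
Proof.
move=> h k; have [_ _ _ _ mM] := h k.
exact: (mmeas_orthogonalization mM (fun w => orthP t w k)).
Qed.

(** The new iterate is computed before the samples of iteration t are drawn, so it shares the past 2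
    b + 2 t of the old state. Thus [xi] is fresh for both points at which it is evaluated. *)
Let meas_WS t : state_meas t -> forall k, mmeas (W t.+1 k : Om (2 * b + 2 * t) -> _).
Proof.
move=> h k.
have mW j : mmeas ((fun w => 1 *: W t j w + (- a) *: orth t j w) : Om (2 * b + 2 * t) -> _).
  by have [mW _ _ _ _] := h j; apply: mmeasD; apply: mmeasZc => //; exact: meas_orth.
rewrite (_ : W t.+1 k = if (tau %| t.+1)%N then fun w => avg (fun j => 1 *: W t j w + (- a) *: orth t j w)
    else fun w => 1 *: W t k w + (- a) *: orth t k w).
  by case: ifP => _ //; exact: mmeas_avg.
by apply/funext => w; rewrite W_S; case: ifP.
Qed.

Let r_xi t : (rank_xi (inr t : slot b) < 2 * b + 2 * t + 1)%N.
Proof. by have [] := draw_bounds b t. Qed.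
Let r_zeta t : (rank_zeta (inr t : slot b) < 2 * b + 2 * t.+1)%N.
Proof. by have [] := draw_bounds b t. Qed.

Let meas_uS t : state_meas t -> forall k, mmeas (u t.+1 k : Om (2 * b + 2 * t + 1) -> _).
Proof.
move=> h k; have [mW mu _ _ _] := h k; have mW' := meas_WS h k.
have [/ltnW le1 _ _] := draw_bounds b t.
rewrite (_ : u t.+1 k = fun w => gs pb k (W t.+1 k w) (xi k (inr t) w) +
  (1 - a) *: (u t k w - gs pb k (W t k w) (xi k (inr t) w))); last first.
  by apply/funext => w; rewrite u_S.
have mx : measurable_fun setT (xi k (inr t) : Om (2 * b + 2 * t + 1) -> _).
  exact: xi_past (r_xi t).
apply: mmeasD.
  by apply: (oracle_meas (oracle_gs asm k)) => //; exact: mmeas_past le1 mW'.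
apply: mmeasZc; apply: mmeasB; first exact: mmeas_past le1 mu.
by apply: (oracle_meas (oracle_gs asm k)) => //; exact: mmeas_past le1 mW.
Qed.

Let meas_HS t : state_meas t -> forall k, mmeas (H t.+1 k : Om (2 * b + 2 * t + 1) -> _).
Proof.
move=> h k; have [mW _ _ mH _] := h k; have mW' := meas_WS h k.
have [/ltnW le1 _ _] := draw_bounds b t.
rewrite (_ : H t.+1 k = fun w => proj_ball (C_g c) (grad_gs (W t.+1 k w) (xi k (inr t) w) +
  (1 - a) *: (H t k w - grad_gs (W t k w) (xi k (inr t) w)))); last first.
  by apply/funext => w; rewrite H_S.
have mx : measurable_fun setT (xi k (inr t) : Om (2 * b + 2 * t + 1) -> _).
  exact: xi_past (r_xi t).
apply: mmeas_proj_ball; first exact: C_g_gt0.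
apply: mmeasD.
  by apply: (oracle_meas (oracle_grad_gs asm k)) => //; exact: mmeas_past le1 mW'.
apply: mmeasZc; apply: mmeasB; first exact: mmeas_past le1 mH.
by apply: (oracle_meas (oracle_grad_gs asm k)) => //; exact: mmeas_past le1 mW.
Qed.

Let meas_vS t : state_meas t -> forall k, mmeas (v t.+1 k : Om (2 * b + 2 * t.+1) -> _).
Proof.
move=> h k; have [_ mu mv _ _] := h k; have mu' := meas_uS h k.
have [_ /ltnW le2 /ltnW le1] := draw_bounds b t.
rewrite (_ : v t.+1 k = fun w => proj_ball (C_f c) (grad_fs (u t.+1 k w) (zeta k (inr t) w) +
  (1 - a) *: (v t k w - grad_fs (u t k w) (zeta k (inr t) w)))); last first.
  by apply/funext => w; rewrite v_S.
have mx : measurable_fun setT (zeta k (inr t) : Om (2 * b + 2 * t.+1) -> _).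
  exact: zeta_past (r_zeta t).
apply: mmeas_proj_ball; first exact: C_f_gt0.
apply: mmeasD.
  by apply: (oracle_meas (oracle_grad_fs asm k)) => //; exact: mmeas_past le2 mu'.
apply: mmeasZc; apply: mmeasB; first exact: mmeas_past le1 mv.
by apply: (oracle_meas (oracle_grad_fs asm k)) => //; exact: mmeas_past le1 mu.
Qed.

(** The ranks below b are those of the initial batch of [xi], so the whole initial batch of [zeta]
    is fresh for [u_0]. *)
Let meas_u0 k : mmeas (u 0 k : Om b -> _).
Proof.
rewrite (_ : u 0 k = fun w => avg (fun j => gs pb k W0 (xi k (inl j) w))); last first.
  by apply/funext => w; rewrite u_0.
apply: mmeas_avg => j; apply: (oracle_meas (oracle_gs asm k)); first exact: mmeas_cst.
by apply: xi_past; exact: ltn_ord.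
Qed.

Let meas_state t : state_meas t.
Proof.
elim: t => [|t ih].
  have [bb _ _] := batch_bounds b0.
  have mu k : mmeas (u 0 k : Om (2 * b + 2 * 0) -> _) by exact: mmeas_past bb (meas_u0 k).
  have mH k : mmeas (H 0 k : Om (2 * b + 2 * 0) -> _).
    rewrite (_ : H 0 k = fun w => avg (fun j => grad_gs W0 (xi k (inl j) w))); last first.
      by apply/funext => w; rewrite H_0.
    apply: mmeas_avg => j; apply: (oracle_meas (oracle_grad_gs asm k)); first exact: mmeas_cst.
    by apply: xi_past; have [] := batch_bounds (ltn_ord j).
  have mv k : mmeas (v 0 k : Om (2 * b + 2 * 0) -> _).
    rewrite (_ : v 0 k = fun w => avg (fun j => grad_fs (u 0 k w) (zeta k (inl j) w))); last first.
      by apply/funext => w; rewrite v_0.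
    apply: mmeas_avg => j; apply: (oracle_meas (oracle_grad_fs asm k)) => //.
    by apply: zeta_past; have [] := batch_bounds (ltn_ord j).
  move=> k; split => //.
    by rewrite (_ : W 0 k = fun=> W0); [exact: mmeas_cst|apply/funext => w; rewrite W_0].
  rewrite (_ : M 0 k = fun w => avg (fun j => H 0 j w *m kronI n (v 0 j w))).
    by apply: mmeas_avg => j; apply: mmeas_mul => //; exact: mmeas_kronI.
  by apply/funext => w; rewrite M_0.
have [_ /ltnW le2 /ltnW le1] := draw_bounds b t.
have mH k := mmeas_past le2 (meas_HS ih k).
move=> k; split.
- exact: mmeas_past le1 (meas_WS ih k).
- exact: mmeas_past le2 (meas_uS ih k).
- exact: meas_vS.
- exact: mH.
have mM j : mmeas ((fun w => (1 - r) *: M t j w + r *: (H t.+1 j w *m kronI n (v t.+1 j w)))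
    : Om (2 * b + 2 * t.+1) -> _).
  have [_ _ _ _ mM] := ih j.
  apply: mmeasD; apply: mmeasZc; first exact: mmeas_past le1 mM.
  by apply: mmeas_mul => //; apply: mmeas_kronI; exact: meas_vS.
rewrite (_ : M t.+1 k = if (tau %| t.+1)%N
    then fun w => avg (fun j => (1 - r) *: M t j w + r *: (H t.+1 j w *m kronI n (v t.+1 j w)))
    else fun w => (1 - r) *: M t k w + r *: (H t.+1 k w *m kronI n (v t.+1 k w))).
  by case: ifP => _ //; exact: mmeas_avg.
by apply/funext => w; rewrite M_S; case: ifP.
Qed.

Let meas_Omega t k : [/\ mmeas (W t k), mmeas (u t k), mmeas (v t k), mmeas (H t k) & mmeas (M t k)].
Proof. 
have [h1 h2 h3 h4 h5] := meas_state t k.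
by split; [exact (mmeas_Omega smp h1)|exact (mmeas_Omega smp h2)
  |exact (mmeas_Omega smp h3)|exact (mmeas_Omega smp h4)|exact (mmeas_Omega smp h5)].
Qed.

Let xi_fresh_t t k A B : <<s past xi zeta (2 * b + 2 * t) >> A -> measurable B ->
  P (A `&` xi k (inr t) @^-1` B) = (P A * Dg pb k B)%E.
Proof. exact: (xi_fresh smp (k := k) (s := inr t)). Qed.

Let zeta_fresh_t t k A B : <<s past xi zeta (2 * b + 2 * t + 1) >> A -> measurable B ->
  P (A `&` zeta k (inr t) @^-1` B) = (P A * Df pb k B)%E.
Proof. exact: (zeta_fresh smp (k := k) (s := inr t)). Qed.

Let om0 : 0 <= om. Proof. exact: omega_ge0. Qed.

(** * Mean-square errors of the three estimators *)

Let mean_W_incr t k :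
  mean_le P (fun w => fnorm (W t.+1 k w - W t k w) ^+ 2) (om ^+ 2 * a ^+ 2).
Proof.
have [mW _ _ _ _] := meas_Omega t k; have [mW' _ _ _ _] := meas_Omega t.+1 k.
apply: (mean_le_mono (g := fun=> om ^+ 2 * a ^+ 2)).
- by apply: measurable_sqr_fnorm; exact: mmeasB.
- by move=> w; rewrite sqr_ge0/=.
- by apply: mean_le_cst; rewrite mulr_ge0 ?sqr_ge0.
Qed.

Let Eu := err_u n tau0 c.
Let EH := err_H n tau0 c.
Let Ev := err_v n tau0 c.
Let Eu0 : 0 <= Eu. Proof. exact: err_u_ge0. Qed.
Let EH0 : 0 <= EH. Proof. exact: err_H_ge0. Qed.
Let Ev0 : 0 <= Ev. Proof. exact: err_v_ge0. Qed.

Let mean_u t k : mean_le P (fun w => fnorm (u t k w - g pb k (W t k w)) ^+ 2) (Eu * a).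
Proof.
elim: t => [|t ih].
  apply: (mean_leW (a := sigma_g c ^+ 2 / b%:R)).
    rewrite bE; apply: ler_wpM2r; first exact: ltW.
    rewrite /Eu /err_u -[leLHS]add0r; apply: lerD; first exact: mul_sqr2_ge0.
    by rewrite ler_peMl ?sqr_ge0// ler1n.
  rewrite (_ : (fun _ => _) = (fun w => fnorm
      (avg (fun j => gs pb k W0 (xi k (inl j) w)) - g pb k W0) ^+ 2)); last first.
    by apply/funext => w; rewrite u_0 W_0.
  apply: (batch_error (oracle_gs asm k) (xs := fun j => xi k (inl j)) (Y := fun=> W0) b0).
  move=> j; exists (past xi zeta j); split.
  - by move=> A hA; exact: (past_measurable smp hA).
  - exact: (xi_measurable smp).
  - by move=> A B; exact: (xi_fresh smp (k := k) (s := inl j)).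
  - exact: mmeas_cst.
  - by move=> i ij; exact: xi_past.
have [mW mu _ _ _] := meas_state t k; have mW' := meas_WS (meas_state t) k.
have h := storm_error (oracle_gs asm k) (past_measurable smp (r := 2 * b + 2 * t))
  (xi_measurable smp (k := k) (inr t)) (@xi_fresh_t t k) mW mW' mu a ih (mean_W_incr t k).
rewrite (_ : (fun _ => _) = (fun w => fnorm (gs pb k (W t.+1 k w) (xi k (inr t) w) +
   (1 - a) *: (u t k w - gs pb k (W t k w) (xi k (inr t) w)) - g pb k (W t.+1 k w)) ^+ 2));
  last by apply/funext => w; rewrite u_S.
apply: mean_leW h.
rewrite (_ : 8 * C_g c ^+ 2 * (om ^+ 2 * a ^+ 2) + 2 * a ^+ 2 * sigma_g c ^+ 2 =
  (8 * C_g c ^+ 2 * om ^+ 2 + 2 * sigma_g c ^+ 2) * a ^+ 2); last by ring.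
apply: storm_fixpoint => //; rewrite /Eu /err_u lerD2l.
by apply: ler_wpM2r; [exact: sqr_ge0|rewrite ler_nat].
Qed.

Let mean_H t k : mean_le P (fun w => fnorm (H t k w - jac (g pb k) (W t k w)) ^+ 2) (EH * a).
Proof.
elim: t => [|t ih].
  apply: (mean_leW (a := sigma_jac_g c ^+ 2 / b%:R)).
    rewrite bE; apply: ler_wpM2r; first exact: ltW.
    rewrite /EH /err_H -[leLHS]add0r; apply: lerD; first exact: mul_sqr2_ge0.
    by rewrite ler_peMl ?sqr_ge0// ler1n.
  rewrite (_ : (fun _ => _) = (fun w => fnorm
      (avg (fun j => grad_gs W0 (xi k (inl j) w)) - jac (g pb k) W0) ^+ 2)); last first.
    by apply/funext => w; rewrite H_0 W_0.
  apply: (batch_error (oracle_grad_gs asm k) (xs := fun j => xi k (inl j)) (Y := fun=> W0) b0).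
  move=> j; exists (past xi zeta j); split.
  - by move=> A hA; exact: (past_measurable smp hA).
  - exact: (xi_measurable smp).
  - by move=> A B; exact: (xi_fresh smp (k := k) (s := inl j)).
  - exact: mmeas_cst.
  - by move=> i ij; exact: xi_past.
have [mW _ _ mH _] := meas_state t k; have mW' := meas_WS (meas_state t) k.
have h := storm_error (oracle_grad_gs asm k) (past_measurable smp (r := 2 * b + 2 * t))
  (xi_measurable smp (k := k) (inr t)) (@xi_fresh_t t k) mW mW' mH a ih (mean_W_incr t k).
have [mWO _ _ mHO _] := meas_Omega t.+1 k.
apply: mean_le_mono (mean_leW _ h).
- apply: measurable_sqr_fnorm; apply: mmeasB => //.
  exact: oracle_meas_mean (oracle_grad_gs asm k) _ _ _ mWO.
- move=> w; rewrite sqr_ge0/= H_S ler_pXn2r ?nnegrE ?fnorm_ge0//.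
  by apply: proj_ball_nonexp; [exact: C_g_gt0|exact: jac_g_le].
rewrite (_ : 8 * L_g c ^+ 2 * (om ^+ 2 * a ^+ 2) + 2 * a ^+ 2 * sigma_jac_g c ^+ 2 =
  (8 * L_g c ^+ 2 * om ^+ 2 + 2 * sigma_jac_g c ^+ 2) * a ^+ 2); last by ring.
apply: storm_fixpoint => //; rewrite /EH /err_H lerD2l.
by apply: ler_wpM2r; [exact: sqr_ge0|rewrite ler_nat].
Qed.

Let mean_u_incr t k : mean_le P (fun w => fnorm (u t.+1 k w - u t k w) ^+ 2)
  (incr_u n tau0 c * a ^+ 2).
Proof.
have [mW mu _ _ _] := meas_state t k; have mW' := meas_WS (meas_state t) k.
have h := storm_increment (oracle_gs asm k) (past_measurable smp (r := 2 * b + 2 * t))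
  (xi_measurable smp (k := k) (inr t)) (@xi_fresh_t t k) mW mW' mu a (mean_u t k) (mean_W_incr t k).
rewrite (_ : (fun _ => _) = (fun w => fnorm (gs pb k (W t.+1 k w) (xi k (inr t) w) +
   (1 - a) *: (u t k w - gs pb k (W t k w) (xi k (inr t) w)) - u t k w) ^+ 2));
  last by apply/funext => w; rewrite u_S.
apply: mean_leW h; rewrite /incr_u -/Eu -/om.
(* The error term provides 4 a^2 times Eu a; the surplus factor a <= 1 is dropped. *)
have : 0 <= (4 * a ^+ 2 * Eu) * (1 - a).
  by rewrite mulr_ge0 ?subr_ge0// mulr_ge0// mulr_ge0 ?sqr_ge0.
lra.
Qed.

Let mean_v t k : mean_le P (fun w => fnorm (v t k w - grad (f pb k) (u t k w)) ^+ 2) (Ev * a).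
Proof.
elim: t => [|t ih].
  apply: (mean_leW (a := sigma_f c ^+ 2 / b%:R)).
    rewrite bE; apply: ler_wpM2r; first exact: ltW.
    rewrite /Ev /err_v -[leLHS]add0r; apply: lerD.
      by rewrite mulr_ge0 ?incr_u_ge0// mul_sqr_ge0.
    by rewrite ler_peMl ?sqr_ge0// ler1n.
  rewrite (_ : (fun _ => _) = (fun w => fnorm
      (avg (fun j => grad_fs (u 0 k w) (zeta k (inl j) w)) - grad (f pb k) (u 0 k w)) ^+ 2));
    last by apply/funext => w; rewrite v_0.
  apply: (batch_error (oracle_grad_fs asm k) (xs := fun j => zeta k (inl j)) (Y := u 0 k) b0).
  move=> j; exists (past xi zeta (b + j)); split.
  - by move=> A hA; exact: (past_measurable smp hA).
  - exact: (zeta_measurable smp).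
  - by move=> A B; exact: (zeta_fresh smp (k := k) (s := inl j)).
  - by apply: mmeas_past (meas_u0 k); rewrite leq_addr.
  - by move=> i ij; apply: zeta_past; rewrite /= ltn_add2l.
have [_ mu mv _ _] := meas_state t k; have mu' := meas_uS (meas_state t) k.
have [/ltnW le1 _ _] := draw_bounds b t.
(* The past now includes [xi] of iteration t, so the old and the new [u] are both frozen when [zeta]
   is drawn; [mean_u_incr] supplies the displacement. *)
have h := storm_error (oracle_grad_fs asm k) (past_measurable smp (r := 2 * b + 2 * t + 1))
  (zeta_measurable smp (k := k) (inr t)) (@zeta_fresh_t t k) (mmeas_past le1 mu) mu'
  (mmeas_past le1 mv) a ih (mean_u_incr t k).
have [_ muO mvO _ _] := meas_Omega t.+1 k.
apply: mean_le_mono (mean_leW _ h).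
- apply: measurable_sqr_fnorm; apply: mmeasB => //.
  exact: oracle_meas_mean (oracle_grad_fs asm k) _ _ _ muO.
- move=> w; rewrite sqr_ge0/= v_S ler_pXn2r ?nnegrE ?fnorm_ge0//.
  by apply: proj_ball_nonexp; [exact: C_f_gt0|exact: grad_f_le].
rewrite (_ : 8 * L_f c ^+ 2 * (incr_u n tau0 c * a ^+ 2) + 2 * a ^+ 2 * sigma_f c ^+ 2 =
  (8 * L_f c ^+ 2 * incr_u n tau0 c + 2 * sigma_f c ^+ 2) * a ^+ 2); last by ring.
apply: storm_fixpoint => //; rewrite /Ev /err_v lerD2l.
by apply: ler_wpM2r; [exact: sqr_ge0|rewrite ler_nat].
Qed.

(** [mean_le_sqrt] at the scale s = r, the root of a: r + E a / r = (1 + E) r. *)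
Let mean_root p q (X : Omega -> 'M[R]_(p, q)) E : mmeas X ->
  mean_le P (fun w => fnorm (X w) ^+ 2) (E * a) ->
  mean_le P (fun w => fnorm (X w)) ((1 + E) * r).
Proof.
move=> mX hX; have h := mean_le_sqrt r0 (measurable_fnorm mX) (fun w => fnorm_ge0 (X w)) hX.
apply: mean_leW h; rewrite /a expr2 mulrDl mul1r lerD2l.
by rewrite mulrCA mulKf ?gt_eqF.
Qed.

(** * Error of the averaged momentum *)

Let est t k w := sn * (C_f c * fnorm (H t k w - jac (g pb k) (W t k w)) +
  C_g c * (fnorm (v t k w - grad (f pb k) (u t k w)) +
           `|L_f c| * fnorm (u t k w - g pb k (W t k w)))).

Let mean_est t k : mean_le P (est t k) (err_est n tau0 c * r).
Proof.
have [mW mu mv mH _] := meas_Omega t k.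
have mH' : mmeas (fun w => H t k w - jac (g pb k) (W t k w)).
  by apply: mmeasB => //; exact: oracle_meas_mean (oracle_grad_gs asm k) _ _ _ mW.
have mu' : mmeas (fun w => u t k w - g pb k (W t k w)).
  by apply: mmeasB => //; exact: oracle_meas_mean (oracle_gs asm k) _ _ _ mW.
have mv' : mmeas (fun w => v t k w - grad (f pb k) (u t k w)).
  by apply: mmeasB => //; exact: oracle_meas_mean (oracle_grad_fs asm k) _ _ _ mu.
have hH := mean_root mH' (mean_H t k); have hu := mean_root mu' (mean_u t k).
have hv := mean_root mv' (mean_v t k).
rewrite /est /err_est -/sn -/Eu -/EH -/Ev -mulrA; apply: mean_leZ => //.
rewrite mulrDl -!mulrA; apply: mean_leD; first exact: mean_leZ.
apply: mean_leZ => //; rewrite mulrDl -mulrA; apply: mean_leD => //.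
by apply: mean_leZ.
Qed.

Let v_err t k w : fnorm (v t k w - grad (f pb k) (g pb k (W t k w))) <=
  fnorm (v t k w - grad (f pb k) (u t k w)) + `|L_f c| * fnorm (u t k w - g pb k (W t k w)).
Proof.
apply: le_trans (ler_fnorm_trans (grad (f pb k) (u t k w)) _ _) _.
by rewrite lerD2l; exact: grad_f_lip.
Qed.

Let est_bound t k w :
  fnorm (H t.+1 k w *m kronI n (v t.+1 k w) - client_grad pb k (W t.+1 k w)) <= est t.+1 k w.
Proof.
apply: le_trans (kron_diff _ _ _ _) _; rewrite /est; apply: ler_wpM2l => //.
apply: lerD; first by rewrite mulrC; apply: ler_wpM2r => //; exact: fnorm_ge0.
by apply: ler_pM; rewrite ?fnorm_ge0//; exact: jac_g_le.
Qed.

(** The initial [v] is unprojected, so |v_0| is only bounded by C_f plus its error. The resulting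
    product of errors is at most the sum of their squares; this is the source of [err_H + err_v] in
    [err_Mbar]. *)
Let est0_bound k w :
  fnorm (H 0 k w *m kronI n (v 0 k w) - client_grad pb k (W 0 k w)) <= est 0 k w +
  sn * (fnorm (H 0 k w - jac (g pb k) (W 0 k w)) ^+ 2 +
        fnorm (v 0 k w - grad (f pb k) (u 0 k w)) ^+ 2).
Proof.
apply: le_trans (kron_diff _ _ _ _) _; rewrite /est -mulrDr; apply: ler_wpM2l => //.
set h := fnorm (H 0 k w - _); set e := fnorm (v 0 k w - grad _ (u 0 k w)).
have h0 : 0 <= h by exact: fnorm_ge0.
have vle : fnorm (v 0 k w) <= e + C_f c.
  rewrite -[v 0 k w](subrK (grad (f pb k) (u 0 k w))).
  by apply: le_trans (ler_fnormD _ _) _; rewrite lerD2l; exact: grad_f_le.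
have h1 := ler_wpM2l h0 vle.
have h2 : fnorm (jac (g pb k) (W 0 k w)) * fnorm (v 0 k w - grad (f pb k) (g pb k (W 0 k w)))
    <= C_g c * (e + `|L_f c| * fnorm (u 0 k w - g pb k (W 0 k w))).
  by apply: ler_pM; rewrite ?fnorm_ge0//; exact: jac_g_le.
have := sqr_ge0 (h - e); have := sqr_ge0 h; have := sqr_ge0 e; lra.
Qed.

Let gradF t w := grad (objective pb) (Wbar t w).
Let dM t w := fnorm (Mbar t w - gradF t w).

Let meas_Wbar t : mmeas (Wbar t).
Proof. by apply: mmeas_avg => k; have [] := meas_Omega t k. Qed.

Let meas_gradF t : mmeas (gradF t).
Proof.
rewrite (_ : gradF t = fun w => avg (fun k => client_grad pb k (Wbar t w))); last first.
  by apply/funext => w; rewrite /gradF grad_objective.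
apply: mmeas_avg => k; apply: mmeas_mul.
  exact: (oracle_meas_mean (oracle_grad_gs asm k) (meas_Wbar t)).
apply: mmeas_kronI; apply: (oracle_meas_mean (oracle_grad_fs asm k)).
exact: (oracle_meas_mean (oracle_gs asm k) (meas_Wbar t)).
Qed.

Let meas_dM t : measurable_fun setT (dM t).
Proof.
apply: measurable_fnorm; apply: mmeasB => //.
by apply: mmeas_avg => k; have [] := meas_Omega t k.
Qed.

Let dM_0 w : dM 0 w <= avg (fun k => est 0 k w +
  sn * (fnorm (H 0 k w - jac (g pb k) (W 0 k w)) ^+ 2 +
        fnorm (v 0 k w - grad (f pb k) (u 0 k w)) ^+ 2) : R^o).
Proof.
have WE : Wbar 0 w = W0.
  by rewrite /Wbar (_ : (W 0)^~ w = fun=> W0) ?avg_cst//; apply/funext => i; rewrite W_0.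
have ME : Mbar 0 w = avg (fun j => H 0 j w *m kronI n (v 0 j w)).
  rewrite /Mbar (_ : (M 0)^~ w = fun=> avg (fun j => H 0 j w *m kronI n (v 0 j w))) ?avg_cst//.
  by apply/funext => i; rewrite M_0.
rewrite /dM /gradF ME WE grad_objective avgB; apply: le_trans (fnorm_avg _) _.
by apply: ler_avg => k; have := est0_bound k w; rewrite W_0.
Qed.

(** The new error splits into the contracted old one, the motion of the gradient between consecutive
    averages, and r times the error of the new estimate, measured at the clients and then moved to
    their average. *)
Let dM_S t w : dM t.+1 w <= (1 - r) * dM t w + (L * (a * sn) +
  r * (avg (fun k => est t.+1 k w : R^o) + L * (2 * tau0%:R * (a * sn)))).
Proof.
have E : Mbar t.+1 w - gradF t.+1 w = (1 - r) *: (Mbar t w - gradF t w) +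
    ((1 - r) *: (gradF t w - gradF t.+1 w) +
     r *: (avg (fun k => H t.+1 k w *m kronI n (v t.+1 k w)) - gradF t.+1 w)).
  rewrite Mbar_S -avgZ; set A := avg _; apply/matrixP => i j; rewrite !mxE; ring.
have r'0 : 0 <= 1 - r by rewrite subr_ge0.
rewrite /dM E; apply: le_trans (ler_fnormD _ _) _.
rewrite fnormZ ger0_norm// lerD2l.
apply: le_trans (ler_fnormD _ _) _; apply: lerD.
  rewrite fnormZ ger0_norm//; apply: le_trans (_ : fnorm (gradF t w - gradF t.+1 w) <= _).
    by rewrite ler_piMl ?fnorm_ge0// gerBl ltW.
  apply: le_trans (grad_objective_lip asm c_ok K0 _ _) _.
  by apply: ler_wpM2l => //; rewrite fnormB.
rewrite fnormZ gtr0_norm//; apply: ler_wpM2l; first exact: ltW.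
rewrite /gradF grad_objective avgB; apply: le_trans (fnorm_avg _) _.
rewrite -[X in _ <= _ + X](avg_const K0).
rewrite /avg -scalerDr -big_split; apply: (ler_avg (K := K)) => k /=.
apply: le_trans (ler_fnorm_trans (client_grad pb k (W t.+1 k w)) _ _) _.
apply: lerD; first exact: est_bound.
apply: le_trans (client_grad_lip asm c_ok _ _ _) _.
by apply: ler_wpM2l.
Qed.

Let Ce := err_Mbar n tau0 c.
Let est_ge0 : 0 <= err_est n tau0 c.
Proof.
have h1 : 0 <= 1 + EH by rewrite addr_ge0.
have h2 : 0 <= 1 + Ev by rewrite addr_ge0.
have h3 : 0 <= 1 + Eu by rewrite addr_ge0.
by apply: mulr_ge0 => //; apply: addr_ge0; apply: mulr_ge0 => //; apply: addr_ge0 => //; exact: mulr_ge0.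
Qed.

(** Absorbs the motion of the average and the spread of the clients into the term [2 * omega] of
    [err_Mbar]. *)
Let sn_om : sn + 2 * tau0%:R * sn <= 2 * om.
Proof.
rewrite /om /omega -/sn.
have : 0 <= sn * tau0%:R by rewrite mulr_ge0.
have := sn0; lra.
Qed.

Let mean_dM t : mean_le P (dM t) (Ce * r).
Proof.
elim: t => [|t ih].
  apply: mean_le_mono (meas_dM 0) _ _; first by move=> w; rewrite fnorm_ge0/=; exact: dM_0.
  apply: mean_le_avg => // k.
  apply: (mean_leW (a := err_est n tau0 c * r + sn * (EH * a + Ev * a))).
    rewrite /Ce /err_Mbar -/L -/om -/sn -/EH -/Ev.
    have ra : 0 <= r - a by rewrite subr_ge0.
    have h1 := mulr_ge0 (mulr_ge0 sn0 (addr_ge0 EH0 Ev0)) ra.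
    have h2 := mulr_ge0 (mulr_ge0 L0 om0) (ltW r0).
    lra.
  apply: mean_leD; first exact: mean_est.
  by apply: mean_leZ => //; apply: mean_leD; [exact: mean_H|exact: mean_v].
apply: mean_le_mono (meas_dM t.+1) _ _; first by move=> w; rewrite fnorm_ge0/=; exact: dM_S.
apply: (mean_leW (a := (1 - r) * (Ce * r) + (L * (a * sn) +
    r * (err_est n tau0 c * r + L * (2 * tau0%:R * (a * sn)))))).
  (* Contraction frees Ce a, since r^2 = a. This must dominate the gradient motion, the estimator
     error and the client spread, which are all of order a. *)
  have -> : (1 - r) * (Ce * r) = Ce * r - Ce * a by rewrite /a; ring.
  rewrite /Ce /err_Mbar -/L -/om -/sn -/EH -/Ev.
  have -> : r * (err_est n tau0 c * r + L * (2 * tau0%:R * (a * sn))) =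
     err_est n tau0 c * a + a * (L * (2 * tau0%:R * sn)) * r by rewrite /a; ring.
  have h1 := mulr_ge0 (mulr_ge0 sn0 (addr_ge0 EH0 Ev0)) (ltW a0).
  have h2' : 0 <= 2 * om - (sn + 2 * tau0%:R * sn) by rewrite subr_ge0.
  have h2 := mulr_ge0 (mulr_ge0 (ltW a0) L0) h2'.
  have h3' : 0 <= 2 * tau0%:R * sn by rewrite mulr_ge0// mulr_ge0.
  have r'0 : 0 <= 1 - r by rewrite subr_ge0.
  have h3 := mulr_ge0 (mulr_ge0 (ltW a0) (mulr_ge0 L0 h3')) r'0.
  lra.
have asn2 : 0 <= 2 * tau0%:R * (a * sn) by rewrite mulr_ge0// mulr_ge0.
apply: mean_leD; first by apply: mean_leZ => //; rewrite subr_ge0.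
apply: mean_leD; first by apply: mean_le_cst; exact: mulr_ge0.
apply: mean_leZ; first exact: ltW.
apply: mean_leD; last by apply: mean_le_cst; exact: mulr_ge0.
by apply: mean_le_avg => // k; exact: mean_est.
Qed.

(** * Descent of the objective and summation over the iterations *)

Let dev : R := 2 * tau0%:R * (r * (sn * (C_g c * C_f c))).

Let descent t w : objective pb (Wbar t.+1 w) + a * fnorm (gradF t w) <=
  objective pb (Wbar t w) + (a * (1 + sn) * (dM t w + dev) + L * n%:R * a ^+ 2).
Proof.
have h := objective_descent asm c_ok K0 (Wbar t w) (avg (fun k => (- a) *: orth t k w)).
rewrite -Wbar_S in h.
have sq : fnorm (avg (fun k => (- a) *: orth t k w)) ^+ 2 <= n%:R * a ^+ 2.
  rewrite -[n%:R]sqr_sqrtr// -exprMn ler_pXn2r ?nnegrE ?fnorm_ge0 1?mulrC//.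
  by apply: (fnorm_avg_le K0) => k.
have {}sq := ler_wpM2l L0 sq.
(* For each client, with G the gradient and O the orthogonal factor, -<G, O> <= -|M| + sqrt n |M -
   G| <= -|G| + (1 + sqrt n) |M - G|. *)
suff lin : dotm (gradF t w) (avg (fun k => (- a) *: orth t k w)) <=
    a * (1 + sn) * (dM t w + dev) - a * fnorm (gradF t w).
  by move: h lin sq; rewrite -/L -/(gradF t w); lra.
rewrite /avg dotmZr dotm_sumr.
apply: (avg_le K0 (F := fun k => dotm (gradF t w) ((- a) *: orth t k w))) => k.
rewrite dotmZr mulNr lerNl opprB -mulrA -mulrBr; apply: ler_wpM2l; first exact: ltW.
have h1 := orthogonalization_dotm (orthP t w k).
have h2 := dotm_le (M t k w - gradF t w) (orth t k w).
have h3 := ler_fnorm_trans (Mbar t w) (M t k w) (gradF t w).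
have h4 := M_cons t w k.
have h5 := orthogonalization_norm (orthP t w k).
have h6 : fnorm (gradF t w) <= fnorm (M t k w - gradF t w) + fnorm (M t k w).
  have := ler_fnormB (M t k w) (M t k w - gradF t w); rewrite opprB addrC subrK; lra.
have h7 : fnorm (M t k w - gradF t w) <= dM t w + dev by rewrite /dM /dev; lra.
have h8 := ler_wpM2l (fnorm_ge0 (M t k w - gradF t w)) h5; rewrite -/sn in h8.
have h9 := ler_wpM2r sn0 h7.
rewrite dotmDl dotmNl in h2; lra.
Qed.

Let Fstar := inf (range (objective pb)).

Let Fstar_le X : Fstar <= objective pb X.
Proof.
by apply: ge_inf; [exact: objective_bounded_below asm|exists X].
Qed.

Let meas_F t : measurable_fun setT (fun w => objective pb (Wbar t w)).
Proof.
apply: (measurable_caratheodory (phi := fun X (_ : Omega) => objective pb X) (x := id)) => //.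
by move=> _ X; exact: (differentiable_continuous (differentiable_objective pb X)).
Qed.

Lemma trajectory_rate gap T : objective pb W0 - Fstar = gap -> T%:R * r ^+ 3 = 1 ->
  (\sum_(i < T) 'E_P[fun w => fnorm (grad (objective pb) (avg ((W i)^~ w)))] <=
    (T%:R * (rate_const n tau0 c gap * r))%:E)%E.
Proof.
move=> gapE Tr.
suff [_ _] : mean_le P (fun w => \sum_(i < T) fnorm (gradF i w))
    (T%:R * (rate_const n tau0 c gap * r)).
  under eq_integral do rewrite -sumEFin.
  rewrite ge0_integral_sum//=.
  - move=> h.
    rewrite (eq_bigr (fun i : 'I_T => \int[P]_w (fnorm (gradF i w))%:E)%E)// => i _.
    by rewrite unlock.
  - by move=> i; apply: measurable_EFin_comp; exact: measurable_fnorm.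
  - by move=> i w _; rewrite lee_fin fnorm_ge0.
pose e := a * (1 + sn) * (err_M n tau0 c * r) + L * n%:R * a ^+ 2.
have mS t : measurable_fun setT (fun w => \sum_(i < t) fnorm (gradF i w)).
  by apply: measurable_sum => i; exact: measurable_fnorm.
(* Subtracting the infimum makes the potential nonnegative, as [mean_le] demands, so the induction
   needs no prior integrability of the objective along the run. *)
have S t : mean_le P (fun w => (objective pb (Wbar t w) - Fstar) +
    a * \sum_(i < t) fnorm (gradF i w)) (gap + t%:R * e).
  elim: t => [|t ih].
    rewrite (_ : (fun _ => _) = fun=> gap).
      by rewrite mul0r addr0; apply: mean_le_cst; rewrite -gapE subr_ge0.
    apply/funext => w; rewrite big_ord0 mulr0 addr0 -gapE /Wbar.
    rewrite (_ : (W 0)^~ w = fun=> W0) ?avg_cst//.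
    by apply/funext => i; rewrite W_0.
  apply: (mean_le_mono (g := fun w => ((objective pb (Wbar t w) - Fstar) +
    a * \sum_(i < t) fnorm (gradF i w)) +
      (a * (1 + sn) * (dM t w + dev) + L * n%:R * a ^+ 2))).
  - apply: measurable_funD; first by apply: measurable_funB => //; exact: measurable_cst.
    by apply: measurable_funM => //; exact: measurable_cst.
  - move=> w; apply/andP; split.
      rewrite addr_ge0 ?subr_ge0// mulr_ge0 ?(ltW a0)//.
      by apply: sumr_ge0 => i _; exact: fnorm_ge0.
    rewrite big_ord_recr/= mulrDr; have := descent t w; lra.
  - rewrite -natr1 mulrDl mul1r addrA; apply: mean_leD => //.
    have sn1 : 0 <= 1 + sn by rewrite addr_ge0.
    apply: mean_leD; last first.
      by apply: mean_le_cst; rewrite mulr_ge0 ?sqr_ge0// mulr_ge0.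
    apply: mean_leZ; first by rewrite mulr_ge0 ?(ltW a0).
    rewrite /err_M mulrDl; apply: mean_leD; first exact: mean_dM.
    rewrite (_ : 2 * tau0%:R * (Num.sqrt n%:R * (C_g c * C_f c)) * r = dev).
      by apply: mean_le_cst; rewrite /dev !mulr_ge0// ltW.
    by rewrite /dev /sn; ring.
apply: (mean_le_mono (g := fun w => a^-1 * ((objective pb (Wbar T w) - Fstar) +
    a * \sum_(i < T) fnorm (gradF i w)))) => //.
- move=> w; rewrite sumr_ge0/=; last by move=> i _; exact: fnorm_ge0.
  rewrite mulrDr mulKf ?gt_eqF// -[leLHS]add0r lerD2r.
  by rewrite mulr_ge0 ?subr_ge0// invr_ge0 ltW.
apply: mean_leW (mean_leZ _ (S T)); last by rewrite invr_ge0 ltW.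
have T0 : 0 <= T%:R :> R by [].
have rr : r != 0 by rewrite gt_eqF.
(* From T r^3 = 1: dividing by a is multiplying by T r, which produces the factor r of the rate. *)
have -> : a^-1 = T%:R * r.
  apply: (mulfI (lt0r_neq0 a0)); rewrite mulfV ?gt_eqF// -[LHS]Tr /a; ring.
rewrite -mulrA; apply: ler_wpM2l => //; rewrite [rate_const _ _ _ _ * r]mulrC.
apply: ler_wpM2l; first exact: ltW.
rewrite /rate_const -/L -/sn /e -addrA lerD2l.
have -> : T%:R * (a * (1 + sn) * (err_M n tau0 c * r) + L * n%:R * a ^+ 2) =
   (T%:R * r ^+ 3) * ((1 + sn) * err_M n tau0 c) + (T%:R * r ^+ 3) * (L * n%:R * r).
  by rewrite /a; ring.
by rewrite Tr !mul1r lerD2l ler_piMr// mulr_ge0.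
Qed.

End Trajectory.

(** * Rate and complexity *)

Section Rate.
Context {R : realType} {K m n d b : nat} {pb : problem R K m n d} {c : constants R}.
Context {disp : measure_display} {Omega : measurableType disp}.
Variables (P : probability Omega R).
Variables (xi : forall k, slot b -> Omega -> spg pb k).
Variables (zeta : forall k, slot b -> Omega -> spf pb k).
Variables (st : nat -> Omega -> state R K m n d).
Variables (W0 : 'M[R]_(m, n)) (tau tau0 T : nat).
Hypotheses (asm : assumptions pb c) (c_ok : constants_ok c) (K0 : (0 < K)%N).
Hypotheses (smp : is_sampling P xi zeta) (T2 : (2 <= T)%N).
Hypothesis bE : b%:R = T%:R `^ (2 / 3) :> R.
Hypotheses (tau1 : (1 <= tau)%N) (tau_le : (tau <= tau0)%N).
Hypothesis run : is_run (C_g c) (C_f c) (schedule R T tau) W0 xi zeta st.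

Let r : R := T%:R `^ (- (1 / 3)).

Let T0 : 0 < T%:R :> R.
Proof. by rewrite ltr0n; apply: leq_trans T2. Qed.

Let r01 : 0 < r <= 1.
Proof.
rewrite powR_gt0//= -(powRr0 T%:R) ler_powR//; first by rewrite ler1n; apply: leq_trans T2.
Qed.

Let r2 : r ^+ 2 = T%:R `^ (- (2 / 3)).
Proof.
rewrite /r -powR_mulrn ?powR_ge0// -powRrM; congr (_ `^ _); lra.
Qed.

Let r3 : T%:R * r ^+ 3 = 1.
Proof.
rewrite /r -powR_mulrn ?powR_ge0// -powRrM.
rewrite (_ : - (1 / 3) * 3%:R = -1); last by field.
by rewrite powR_inv1 ?(ltW T0)// mulfV// gt_eqF.
Qed.

Let br : b%:R^-1 = r ^+ 2.
Proof. by rewrite r2 bE powRN. Qed.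

Let h : hyperparameters R := Hyperparameters (r ^+ 2) (r ^+ 2) (r ^+ 2) (r ^+ 2) r tau.

Let hE : schedule R T tau = h.
Proof. by rewrite /schedule /h r2. Qed.

Let run' : is_run (C_g c) (C_f c) h W0 xi zeta st.
Proof. by move: run; rewrite hE. Qed.

(** The factor is merely asserted to exist at each outcome; it is selected here by choice, and its
    measurability is recovered from that of the momentum. *)
Let orth t k w : 'M[R]_(m, n) := s2val (cid2 ((run' w).2 t)) k.

Lemma run_rate gap : objective pb W0 - inf (range (objective pb)) = gap ->
  (mean_grad_norm pb P st T <= (rate_const n tau0 c gap * T%:R `^ (- (1 / 3)))%:E)%E.
Proof.
move=> gapE.
have stepP t w k := s2valP' (cid2 ((run' w).2 t)) k.
rewrite /mean_grad_norm (_ : _ * T%:R `^ _ = T%:R^-1 * (T%:R * (rate_const n tau0 c gap * r))).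
  rewrite EFinM; apply: lee_wpmul2l; first by rewrite lee_fin invr_ge0.
  apply: (trajectory_rate asm c_ok K0 smp r01 br tau1 tau_le
    (W := fun t k w => stW (st t w) k) (M := fun t k w => stM (st t w) k)
    (orth := orth) (u := fun t k w => stu (st t w) k) (v := fun t k w => stv (st t w) k)
    (H := fun t k w => stH (st t w) k)) gapE r3.
  - by move=> t w k; exact: (s2valP (cid2 ((run' w).2 t)) k).
  - move=> t w k; have [-> _ _ _ _] := stepP t w k => /=.
    by case: ifP => _; [congr avg; apply/funext => j|]; rewrite scale1r scaleNr.
  - by move=> t w k; have [_ -> _ _ _] := stepP t w k.
  - move=> t w k; have [_ _ /is_projectionE + _ _] := stepP t w k; apply.
    exact: C_f_gt0.
  - move=> t w k; have [_ _ _ /is_projectionE + _] := stepP t w k; apply.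
    exact: C_g_gt0.
  - by move=> t w k; have [_ _ _ _ ->] := stepP t w k.
  - by move=> w k; rewrite (run w).1.
  - by move=> w k; rewrite (run w).1.
  - by move=> w k; rewrite (run w).1.
  - by move=> w k; rewrite (run w).1.
  - by move=> w k; rewrite (run w).1.
by rewrite mulKf// gt_eqF.
Qed.

End Rate.

Lemma communication_rounds_le (tau T : nat) : (0 < tau)%N ->
  (communication_rounds tau T * tau <= T)%N.
Proof.
move=> tau0; rewrite /communication_rounds.
have -> : count (fun t => (tau %| t.+1)%N) (iota 0 T) = (T %/ tau)%N.
  elim: T => [|T ih]; first by rewrite div0n.
  rewrite -addn1 iotaD count_cat ih /= addn0 add0n addn1.
  by rewrite divnS// addnC.
exact: leq_trunc_div.
Qed.

Theorem mainTheorem4 (R : realType) (n tau0 : nat) (gap : R) (c : constants R)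
    (n_gt0 : (0 < n)%N) (tau0_ge1 : (1 <= tau0)%N) (c_ok : constants_ok c) :
  (exists C : R,
     forall (K m d : nat) (pb : problem R K m n d) (W0 : 'M[R]_(m, n)),
     (0 < K)%N -> (0 < m)%N -> (0 < d)%N ->
     assumptions pb c ->
     objective pb W0 - inf (range (objective pb)) = gap ->
     forall T b tau : nat,
     (2 <= T)%N -> b%:R = T%:R `^ (2 / 3) :> R ->
     (1 <= tau <= tau0)%N ->
     forall (disp : measure_display) (Omega : measurableType disp)
       (P : probability Omega R)
       (xi : forall k, slot b -> Omega -> spg pb k)
       (zeta : forall k, slot b -> Omega -> spf pb k)
       (st : nat -> Omega -> state R K m n d),
     is_sampling P xi zeta ->
     is_run (C_g c) (C_f c) (schedule R T tau) W0 xi zeta st ->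
     (mean_grad_norm pb P st T <= (C * T%:R `^ (- (1 / 3)))%:E)%E)
  /\
  (exists C' : R,
     forall (K m d : nat) (pb : problem R K m n d) (W0 : 'M[R]_(m, n)),
     (0 < K)%N -> (0 < m)%N -> (0 < d)%N ->
     assumptions pb c ->
     objective pb W0 - inf (range (objective pb)) = gap ->
     forall (eps : R) (tau : nat),
     0 < eps <= 1 -> (1 <= tau <= tau0)%N ->
     exists T b : nat,
     [/\ (2 <= T)%N, b%:R = T%:R `^ (2 / 3) :> R,
         T%:R <= C' * eps ^- 3,
         (samples_per_client b T)%:R <= C' * eps ^- 3 &
         (communication_rounds tau T)%:R <= T%:R / tau%:R :> R /\
         T%:R / tau%:R <= C' * eps ^- 3] /\
     forall (disp : measure_display) (Omega : measurableType disp)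
       (P : probability Omega R)
       (xi : forall k, slot b -> Omega -> spg pb k)
       (zeta : forall k, slot b -> Omega -> spf pb k)
       (st : nat -> Omega -> state R K m n d),
     is_sampling P xi zeta ->
     is_run (C_g c) (C_f c) (schedule R T tau) W0 xi zeta st ->
     (mean_grad_norm pb P st T <= eps%:E)%E).
Proof.
pose C := rate_const n tau0 c gap.
split.
  exists C => K m d pb W0 K0 _ _ asm gapE T b tau T2 bE /andP[tau1 tau_le] disp Omega P xi zeta st.
  by move=> smp run; exact: (run_rate asm c_ok K0 smp T2 bE tau1 tau_le run gapE).
(* The maximum handles a C of unknown sign; the summand 3 ensures both N >= 2 and C <= B - 1. *)
pose B : R := Num.max C 0 + 3; have B3 : 3 <= B by rewrite lerDr le_max lexx orbT.
have B0 : 0 < B by apply: lt_le_trans B3.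
(* The factor 4 covers the sample count 2 (b + T) <= 4 T. *)
exists (4 * B ^+ 3) => K m d pb W0 K0 _ _ asm gapE eps tau /andP[eps0 eps1] /andP[tau1 tau_le].
(* The horizon is T = N^3, so that T^(2/3) = N^2 is an integer and the rate is C / N. Here B / eps -
   1 < N <= B / eps: the upper bound controls T, the lower one the accuracy. *)
pose N := (Num.truncn (B / eps - 1)).+1.
have Be : B <= B / eps by rewrite ler_pdivlMr// ler_piMr// ltW.
have NB : N%:R <= B / eps.
  by rewrite /N -natr1 -lerBrDr truncn_le; lra.
have NC : B / eps - 1 < N%:R by exact: truncnS_gt.
have N2 : (2 <= N)%N.
  by rewrite -(ltr_nat R); lra.
have N0 : (0 < N)%N by apply: leq_trans N2.
have NR0 : 0 <= N%:R :> R by [].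
have NT : (N <= N ^ 3)%N by rewrite -[leqLHS]expn1 leq_exp2l.
have powN (x : R) k : x * 3%:R = k -> (N ^ 3)%:R `^ x = N%:R `^ k.
  by move=> <-; rewrite natrX -powR_mulrn// -powRrM mulrC.
have T3 : (N ^ 3)%:R <= B ^+ 3 * eps ^- 3.
  by rewrite natrX -exprVn -exprMn ler_pXn2r ?nnegrE ?divr_ge0 ?(ltW B0) ?(ltW eps0).
have bT : (N ^ 2 <= N ^ 3)%N by rewrite leq_exp2l.
have T4 : (N ^ 3)%:R <= 4 * B ^+ 3 * eps ^- 3.
  apply: le_trans T3 _; rewrite -mulrA ler_peMl ?ler1n//.
  by rewrite mulr_ge0 ?invr_ge0 ?exprn_ge0 ?(ltW B0) ?(ltW eps0).
exists (N ^ 3)%N, (N ^ 2)%N; split; first split => //.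
- exact: leq_trans N2 NT.
- by rewrite (@powN _ 2%:R) ?powR_mulrn ?natrX//; field.
- rewrite /samples_per_client -mulrA; apply: le_trans (_ : 4 * (N ^ 3)%:R <= _).
    by rewrite -natrM ler_nat (_ : 4 = 2 * 2)%N// -mulnA leq_mul2l mul2n -addnn leq_add2r.
  by rewrite ler_pM2l.
- split.
    rewrite ler_pdivlMr ?ltr0n// -natrM ler_nat.
    exact: communication_rounds_le.
  apply: le_trans T4; rewrite ler_pdivrMr ?ltr0n// ler_peMr// ler1n//.
move=> disp Omega P xi zeta st smp run.
have T2 : (2 <= N ^ 3)%N by exact: leq_trans N2 NT.
have bE : (N ^ 2)%:R = (N ^ 3)%:R `^ (2 / 3) :> R.
  by rewrite (@powN _ 2%:R) ?powR_mulrn ?natrX//; field.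
apply: le_trans (run_rate asm c_ok K0 smp T2 bE tau1 tau_le run gapE) _.
rewrite lee_fin (@powN _ (-1)); last by field.
rewrite powR_inv1// ler_pdivrMr ?ltr0n//.
have Cmax : C <= Num.max C 0 by rewrite le_max lexx.
have CB : C <= B - 1 by rewrite /B; lra.
(* Since 1 / eps >= 1, (B - 1) / eps <= B / eps - 1 < N. *)
apply: le_trans CB _; rewrite mulrC -ler_pdivrMr//.
apply: le_trans (ltW NC); rewrite mulrBl mul1r lerD2l lerN2.
by rewrite invf_ge1.
Qed.
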